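(* Let $\mathbb{F}$ be a field. Every $\mathbb{F}$-representable matroid $M$ is a minor of an $\mathbb{F}$-representable matroid $N$ such that $\mathrm{cdd}(N)\le 2\,\mathrm{bd}(M)\cdot\big(4^{\mathrm{bd}(M)}-1\big)+1$.
   Context: For a matroid $M$ with rank function $r_M$ and disjoint sets $X,Y$ of elements, $\lambda_M(X,Y)=r_M(X)+r_M(Y)-r_M(X\cup Y)$. For pairwise disjoint sets $X_1,\dots,X_k$ of elements, $\lambda^*_M(X_1,\dots,X_k)=\max_{I\subseteq[k]}\lambda_M\big(\bigcup_{i\in I}X_i,\bigcup_{i\in[k]\setminus I}X_i\big)$. A $(d,r)$-decomposition of a matroid $M$ is a tree $T$ of radius $d$ whose leaves are in one-to-one correspondence with the elements of $M$, such that for every inner (non-leaf) vertex $v$ of $T$ with $k$ neighbours, if $X_1,\dots,X_k$ are the sets of elements of $M$ assigned to the leaves of the $k$ components of $T\setminus v$, then $\lambda^*_M(X_1,\dots,X_k)\le r$. The branch-depth $\mathrm{bd}(M)$ is the minimum $k$ such that $M$ has a $(d,r)$-decomposition with $d\le k$ and $r\le k$. The contraction-deletion-depth $\mathrm{cdd}(M)$ is defined recursively: if $M$ has a single element, $\mathrm{cdd}(M)=1$; if $M$ is not connected, $\mathrm{cdd}(M)$ is the maximum of $\mathrm{cdd}$ over the components of $M$ (restrictions of $M$ to its components, a component being an inclusion-wise maximal set of elements any two of which lie in a common circuit); otherwise $\mathrm{cdd}(M)=1+\min_{e}\min\{\mathrm{cdd}(M/e),\mathrm{cdd}(M\setminus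 e)\}$, the minimum over elements $e$ of $M$. *)

(* Defs.v *)
From HB Require Import structures.
From mathcomp Require Import all_boot all_order all_algebra.
Set Implicit Arguments. Unset Strict Implicit. Unset Printing Implicit Defensive.
Import GRing.Theory.

Record matroid (E : finType) := Matroid {
  rk : {set E} -> nat;
  rk_le_card : forall X, rk X <= #|X|;
  rk_mono : forall X Y : {set E}, X \subset Y -> rk X <= rk Y;
  rk_submod : forall X Y : {set E}, rk (X :|: Y) + rk (X :&: Y) <= rk X + rk Y }.

Definition lam (E : finType) (r : {set E} -> nat) (X Y : {set E}) : nat :=
  r X + r Y - r (X :|: Y).

Definition representable (F : fieldType) (E : finType) (M : matroid E) : Prop :=
  exists (m : nat) (v : E -> 'rV[F]_m),
    forall X : {set E}, rk M X = \dim (<<[seq v x | x in X]>>)%VS.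

Definition is_minor (E E' : finType) (M : matroid E) (N : matroid E') : Prop :=
  exists (C D : {set E'}) (f : E -> E'),
    [/\ [disjoint C & D], injective f,
        (forall y, (y \in codom f) = (y \notin C :|: D)) &
        forall X : {set E}, rk M X = rk N ((f @: X) :|: C) - rk N C].

(* A matroid restricted to ground set S with rank function r (on subsets of S) *)
Section CDD.
Variable T : finType.

Definition circuitb (S : {set T}) (r : {set T} -> nat) (C : {set T}) : bool :=
  [&& C \subset S, r C < #|C| &
      [forall D : {set T}, (D \proper C) ==> (r D == #|D|)]].

Definition common_circuit S r (x y : T) : bool :=
  [exists C : {set T}, [&& circuitb S r C, x \in C & y \in C]].

Definition mconnected (S : {set T}) (r : {set T} -> nat) : bool :=
  [forall x in S, forall y in S, (x != y) ==> common_circuit S r x y].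

Definition component (S : {set T}) (r : {set T} -> nat) (x : T) : {set T} :=
  [set y in S | (y == x) || common_circuit S r x y].

Definition contract_rk (r : {set T} -> nat) (e : T) : {set T} -> nat :=
  fun X => r (e |: X) - r [set e].

Definition seqmin (s : seq nat) : nat := foldr minn (head 0 s) s.

(* fuel-based recursion; fuel #|S| suffices since each call shrinks S *)
Fixpoint cdd_rec (n : nat) (S : {set T}) (r : {set T} -> nat) : nat :=
  match n with
  | 0 => 0
  | n'.+1 =>
    if #|S| == 1 then 1
    else if mconnected S r then
      (seqmin [seq minn (cdd_rec n' (S :\ e) (contract_rk r e))
                        (cdd_rec n' (S :\ e) r) | e <- enum S]).+1
    else \max_(x in S) cdd_rec n' (component S r x) r
  end.
End CDD.

Definition cdd (E : finType) (M : matroid E) : nat :=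
  cdd_rec #|E| [set: E] (rk M).

Definition deg (n : nat) (g : rel 'I_n) (v : 'I_n) : nat := #|[set u | g v u]|.

Definition is_tree (n : nat) (g : rel 'I_n) : Prop :=
  [/\ 0 < n, symmetric g, irreflexive g,
      (forall x y, connect g x y) &
      (forall x y, g x y ->
         ~~ connect (fun a b => g a b && ([set a; b] != [set x; y])) x y)].

Definition radius_le (n : nat) (g : rel 'I_n) (d : nat) : Prop :=
  exists c : 'I_n, forall v : 'I_n,
    exists p : seq 'I_n, [/\ path g c p, last c p = v & size p <= d].

Definition comp_at (n : nat) (g : rel 'I_n) (v u : 'I_n) : {set 'I_n} :=
  [set w | connect (fun a b => g a b && (a != v) && (b != v)) u w].

Definition nbrs (n : nat) (g : rel 'I_n) (v : 'I_n) : {set 'I_n} := [set u | g v u].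

Definition Xpart (E : finType) (n : nat) (g : rel 'I_n) (leaf : E -> 'I_n)
  (v : 'I_n) (I : {set 'I_n}) : {set E} :=
  [set x | [exists u in I, leaf x \in comp_at g v u]].

Definition lambda_star (E : finType) (M : matroid E) (n : nat) (g : rel 'I_n)
  (leaf : E -> 'I_n) (v : 'I_n) : nat :=
  \max_(I : {set 'I_n} | I \subset nbrs g v)
     lam (rk M) (Xpart g leaf v I) (Xpart g leaf v (nbrs g v :\: I)).

(* M has a (d,r)-decomposition with d <= k and r <= k.
   Leaves are the vertices of degree at most 1. *)
Definition has_decomp (E : finType) (M : matroid E) (k : nat) : Prop :=
  exists (n : nat) (g : rel 'I_n) (leaf : E -> 'I_n),
    [/\ is_tree g, radius_le g k, injective leaf,
        (forall v, (v \in codom leaf) = (deg g v <= 1)) &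
        (forall v, 1 < deg g v -> lambda_star M g leaf v <= k)].

Definition is_bd (E : finType) (M : matroid E) (k : nat) : Prop :=
  has_decomp M k /\ forall k', has_decomp M k' -> k <= k'.

(* Main.v *)
From HB Require Import structures.
Require Import Defs.
From mathcomp Require Import all_boot all_order all_algebra.
From mathcomp Require Import zify.
Set Implicit Arguments. Unset Strict Implicit. Unset Printing Implicit Defensive.
Import GRing.Theory VectorInternalTheory.

(** Let [v] represent [M] and let [P] be the set of branches at the root of a decomposition, so
    that every bipartition of [P] has connectivity at most [k]. Choose [Q] in [P] such that
    the connectivity of [I] = the union of [Q] and [J] = the union of [P] minus [Q] is maximal,
    say [s <= k], and contract the [s]-dimensional intersection of the spans of [I] and [J];
    this makes [I] and [J] independent. By maximality, moving a single branch [B] of [I] to the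
    other side gives [r(J + B) - r(J) <= r(I) - r(I - B)], and by submodularity the right-hand
    sides add up to at most [r(I)]. Hence after the contraction the ranks of all branches
    exceed in total the rank of their union by at most [2s], and at most [2s] elementary lifts
    (new coordinates that are linear on each branch, but not on the whole) make all the branches
    independent. A contraction is the contraction of an added element, and a lift is the
    deletion of an added element whose contraction would undo it, so each adds one to the
    depth; each also raises connectivities by at most one. The branches are thus treated
    recursively with [4k] in place of [k], which gives the bound [k (4^k - 1) + 1]. *)

(** * Connectivity and contraction-deletion-depth *)

Section Connectivity.
Variable T : finType.
Implicit Types (r : {set T} -> nat) (A B C D S X Y : {set T}) (e x y : T).

Definition is_matroid_rank r : Prop :=
  [/\ forall X, r X <= #|X|,
      forall X Y, X \subset Y -> r X <= r Y &
      forall X Y, r (X :|: Y) + r (X :&: Y) <= r X + r Y].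

Lemma subset_setUD A S : A \subset S -> A :|: S :\: A = S.
Proof.
move=> AS; apply/setP=> z; rewrite !inE; have [/(subsetP AS)->//|] := boolP (z \in A).
by [].
Qed.

Lemma contract_rkK r e Y : is_matroid_rank r ->
  contract_rk r e Y + r [set e] = r (e |: Y).
Proof. by case=> _ rM _; rewrite /contract_rk subnK // rM // subsetUl. Qed.

Lemma contract_is_matroid_rank r e :
  is_matroid_rank r -> is_matroid_rank (contract_rk r e).
Proof.
move=> rr; have [rC rM rS] := rr; split=> [X|X Y sXY|X Y].
- have := contract_rkK e X rr; have := rS [set e] X; have := rC X; lia.
- have := contract_rkK e X rr; have := contract_rkK e Y rr.
  have := rM _ _ (setUS [set e] sXY); lia.
- have := contract_rkK e (X :|: Y) rr; have := contract_rkK e (X :&: Y) rr.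
  have := contract_rkK e X rr; have := contract_rkK e Y rr.
  have := rS (e |: X) (e |: Y); rewrite -setUIr setUACA setUid; lia.
Qed.

(** Submodularity lets one side shrink at a time: first [A] to [A'] against [B], then [B] to [B']
    against [A']. *)
Lemma skew_sub r A B A' B' : is_matroid_rank r ->
  A' \subset A -> B' \subset B -> r A + r B <= r (A :|: B) ->
  r A' + r B' <= r (A' :|: B').
Proof.
move=> [_ rM rS] sA sB.
have H1 : r (A :|: B) + r A' <= r A + r (A' :|: B).
  have := rS A (A' :|: B); rewrite setUA (setUidPl sA).
  have : r A' <= r (A :&: (A' :|: B)) by rewrite rM // subsetI sA subsetUl.
  lia.
have H2 : r (A' :|: B) + r B' <= r B + r (A' :|: B').
  have := rS B (A' :|: B'); rewrite setUCA (setUidPl sB).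
  have : r B' <= r (B :&: (A' :|: B')) by rewrite rM // subsetI sB subsetUr.
  lia.
lia.
Qed.

Lemma rank0 r : is_matroid_rank r -> r set0 = 0.
Proof. by case=> rC _ _; have := rC set0; rewrite cards0 leqn0 => /eqP. Qed.

Lemma rankU_le r X Y : is_matroid_rank r -> r (X :|: Y) <= r X + r Y.
Proof. by case=> _ _ rS; apply: leq_trans (rS X Y); rewrite leq_addr. Qed.

Lemma rank1_le r x : is_matroid_rank r -> r [set x] <= 1.
Proof. by case=> rC _ _; have := rC [set x]; rewrite cards1. Qed.

(** If [C] met both sides, [C :&: A] and [C :&: B] would be proper, hence independent, subsets of
    [C]. Skewness would add up their ranks and make [C] independent. *)
Lemma circuit_not_crossing S r C A B : is_matroid_rank r ->
  circuitb S r C -> C \subset A :|: B -> [disjoint A & B] ->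
  r A + r B <= r (A :|: B) -> (C \subset A) || (C \subset B).
Proof.
move=> rr /and3P[_ rC /forallP pC] sC dAB sk; apply/norP => -[nA nB].
have indep D : ~~ (C \subset D) -> r (C :&: D) = #|C :&: D|.
  move=> nD; apply/eqP; apply: (implyP (pC _)).
  by rewrite properE subsetIl subsetI subxx.
have CE : (C :&: A) :|: (C :&: B) = C by rewrite -setIUr; apply/setIidPl.
have := skew_sub rr (subsetIr C A) (subsetIr C B) sk.
have := cardsUI (C :&: A) (C :&: B).
rewrite CE setIACA (disjoint_setI0 dAB) setI0 cards0 !indep //; lia.
Qed.

(** Matroid connectivity in terms of ranks. It is easier to uncross than the circuit definition
    [mconnected]; [inseparable_common_circuit] leads back to circuits. *)
Definition inseparable S r : bool :=
  [forall A : {set T}, (A \subset S) && (A != set0) && (A != S) ==>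
     (r S < r A + r (S :\: A))].

Lemma inseparableP S r A : inseparable S r -> A \subset S -> A != set0 ->
  A != S -> r S < r A + r (S :\: A).
Proof. by move=> /forallP /(_ A) /implyP h h1 h2 h3; apply: h; rewrite h1 h2. Qed.

Lemma inseparablePn S r : ~~ inseparable S r ->
  exists2 A : {set T}, [&& A \subset S, A != set0 & A != S] & r A + r (S :\: A) <= r S.
Proof.
case/forallPn=> A; rewrite negb_imply -leqNgt => /andP[/andP[/andP[h1 h2] h3] h4].
by exists A; rewrite ?h1 ?h2.
Qed.

(** Either [C] is already dependent before the contraction, and then it is a circuit, or [e |: C] is
    one. *)
Lemma circuit_uncontract S r e C : is_matroid_rank r -> e \in S ->
  circuitb (S :\ e) (contract_rk r e) C ->
  exists2 C', circuitb S r C' & C \subset C'.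
Proof.
move=> rr eS /and3P[CS rC /forallP pC]; have [rk rM rS] := rr.
have eC : e \notin C by apply: contraTN CS => eC; apply/subsetPn; exists e; rewrite ?inE ?eqxx.
have CS' : C \subset S by apply: subset_trans CS (subD1set _ _).
have pr D : D \proper C -> r (e |: D) = #|D| + r [set e] /\ r D = #|D|.
  move=> pD; have /eqP := implyP (pC D) pD; have := contract_rkK e D rr.
  have := rankU_le [set e] D rr; have := rk D; lia.
have re := contract_rkK e C rr.
have re1 := rank1_le e rr.
have [dC|iC] := ltnP (r C) #|C|.
  exists C => //; apply/and3P; split=> //; apply/forallP => D; apply/implyP => pD.
  by have [_ ->] := pr D pD.
have e1 : r [set e] = 1.
  by have := rM _ _ (subsetUr [set e] C); lia.
exists (e |: C); last exact: subsetUr.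
apply/and3P; split; first by rewrite subUset sub1set eS.
  by rewrite cardsU1 eC /=; lia.
apply/forallP => D; apply/implyP => pD; apply/eqP.
have eD : D :&: C \subset C by apply: subsetIr.
have DE : D \subset e |: (D :&: C).
  apply/subsetP => z zD; have := subsetP (proper_sub pD) _ zD.
  by rewrite !inE zD.
have [eiD|eiD] := boolP (e \in D).
  have DE' : D = e |: (D :&: C).
    apply/eqP; rewrite eqEsubset DE /= subUset sub1set eiD; exact: subsetIl.
  have pD' : D :&: C \proper C.
    rewrite properE subsetIr subsetI subxx andbT; apply: contraTN pD => sCD.
    by rewrite properE subUset sub1set eiD sCD andbF.
  have [h _] := pr _ pD'.
  rewrite DE' h cardsU1 inE (negbTE eC) andbF e1 addnC //.
have sDC : D \subset C.
  apply/subsetP => z zD; have := subsetP DE _ zD; rewrite !inE => /orP[/eqP ze|/andP[]//].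
  by rewrite ze (negbTE eiD) in zD.
have [->|nDC] := eqVneq D C; first by have := rk C; lia.
by have [|_ ->//] := pr D _; rewrite properEneq nDC.
Qed.

(* Tutte: uncrossing a separation of the deletion with one of the contraction. *)
Lemma inseparable_del_or_contract S r e : is_matroid_rank r -> e \in S ->
  inseparable S r ->
  inseparable (S :\ e) r || inseparable (S :\ e) (contract_rk r e).
Proof.
move=> rr eS cS; apply/norP => -[/inseparablePn[A /and3P[AS A0 AS'] hA]
  /inseparablePn[P /and3P[PS P0 PS'] hP]].
have [_ rM rS] := rr.
set B := S :\ e :\: A in hA; set Q := S :\ e :\: P in hP.
have B0 : B != set0 by rewrite setD_eq0; apply: contra AS' => h; rewrite eqEsubset AS.
have Q0 : Q != set0 by rewrite setD_eq0; apply: contra PS' => h; rewrite eqEsubset PS.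
have eA : e \notin A by apply: contraTN AS => h; apply/subsetPn; exists e; rewrite ?inE ?eqxx.
have hPe : r (e |: P) + r (e |: Q) <= r S + r [set e].
  have := contract_rkK e P rr; have := contract_rkK e Q rr.
  have := contract_rkK e (S :\ e) rr; rewrite setD1K //.
  by move: hP; clear; lia.
have hA' : r A + r B <= r S by apply: leq_trans hA _; apply: rM; apply: subD1set.
have cross Y Z : Y \subset S -> e \notin Y -> S :\: Y = Z -> r Y + r Z <= r S -> Y = set0.
  move=> YS eY <- h; apply/eqP/negPn/negP => n0.
  have YS' : Y != S by apply: contraNneq eY => ->.
  by have := inseparableP cS YS n0 YS'; rewrite ltnNge h.
have AS1 := subset_trans AS (subD1set S e).
have BS1 : B \subset S by apply: subset_trans (subsetDl _ _) (subD1set _ _).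
have eB : e \notin B by rewrite !inE eqxx andbF.
have compl (Y Z : {set T}) : Y \subset S :\ e -> Z \subset S :\ e ->
    S :\: (Y :&: Z) = e |: ((S :\ e :\: Y) :|: (S :\ e :\: Z)).
  move=> sY sZ; apply/setP=> z; rewrite !inE; have [->|ze] := eqVneq z e.
    have /negbTE -> : e \notin Y.
      by apply: contraTN sY => h; apply/subsetPn; exists e; rewrite ?inE ?eqxx.
    by rewrite eS.
  by case: (z \in S); case: (z \in Y); case: (z \in Z).
have BS2 : B \subset S :\ e by apply: subsetDl.
have QS2 : Q \subset S :\ e by apply: subsetDl.
have BK : S :\ e :\: B = A by rewrite setDDr setDv set0U; apply/setIidPr.
have QK : S :\ e :\: Q = P by rewrite setDDr setDv set0U; apply/setIidPr.
have AP : r (A :&: P) + r (e |: (B :|: Q)) <= r S -> A :&: P = set0.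
  apply: cross; [exact: subset_trans (subsetIl _ _) AS1|by rewrite inE (negbTE eA)|].
  exact: compl.
have BQ : r (B :&: Q) + r (e |: (A :|: P)) <= r S -> B :&: Q = set0.
  apply: cross; [exact: subset_trans (subsetIl _ _) BS1|by rewrite inE (negbTE eB)|].
  by rewrite compl // BK QK.
have AQ : r (A :&: Q) + r (e |: (B :|: P)) <= r S -> A :&: Q = set0.
  apply: cross; [exact: subset_trans (subsetIl _ _) AS1|by rewrite inE (negbTE eA)|].
  by rewrite compl // QK.
have BP : r (B :&: P) + r (e |: (A :|: Q)) <= r S -> B :&: P = set0.
  apply: cross; [exact: subset_trans (subsetIl _ _) BS1|by rewrite inE (negbTE eB)|].
  by rewrite compl // BK.
have sub (Y Z : {set T}) : e \notin Y -> r (Y :&: Z) + r (e |: (Y :|: Z)) <= r Y + r (e |: Z).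
  move=> eY; have := rS Y (e |: Z); rewrite setUCA addnC.
  have -> // : Y :&: (e |: Z) = Y :&: Z.
  apply/setP=> z; rewrite !inE; have [->|//] := eqVneq z e.
  by rewrite (negbTE eY).
have e1 := rank1_le e rr.
(* The two submodular inequalities add up to at most twice the rank of [S] plus [r [set e] <= 1].
   Two sums of rank [r S + 1] or more would exceed this, so one of the two opposite corners is a
   separation of [S] and must be empty. *)
have arith a b c d u w p q s t : a + d <= u + p -> b + c <= w + q -> u + w <= s ->
    p + q <= s + t -> t <= 1 -> (a + c <= s) || (b + d <= s) by clear; lia.
have c1 : A :&: P = set0 \/ B :&: Q = set0.
  by case/orP: (arith _ _ _ _ _ _ _ _ _ _ (sub A P eA) (sub B Q eB) hA' hPe e1)
    => [/AP|/BQ]; [left|right].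
have c2 : A :&: Q = set0 \/ B :&: P = set0.
  rewrite addnC in hPe.
  by case/orP: (arith _ _ _ _ _ _ _ _ _ _ (sub A Q eA) (sub B P eB) hA' hPe e1)
    => [/AQ|/BP]; [left|right].
have cA : A :&: (P :|: Q) = A.
  by apply/setIidPl; rewrite /Q subset_setUD.
have cB : B :&: (P :|: Q) = B.
  by apply/setIidPl; rewrite /Q subset_setUD.
have cP : (A :|: B) :&: P = P.
  by apply/setIidPr; rewrite /B subset_setUD.
have cQ : (A :|: B) :&: Q = Q.
  by apply/setIidPr; rewrite /B subset_setUD.
(* In each case the two empty cells make up one of [A], [P], [Q], [B]. *)
case: c1 => h1; case: c2 => h2.
- by case/eqP: A0; rewrite -cA setIUr h1 h2 setU0.
- by case/eqP: P0; rewrite -cP setIUl h1 h2 setU0.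
- by case/eqP: Q0; rewrite -cQ setIUl h1 h2 setU0.
- by case/eqP: B0; rewrite -cB setIUr h1 h2 setU0.
Qed.

(** Elements other than [x] and [y] are deleted or contracted one by one, keeping inseparability by
    the previous lemma, and circuits are lifted back. At the end [S] is [[set x; y]], which is
    itself a circuit. *)
Lemma inseparable_common_circuit S r x y : is_matroid_rank r -> inseparable S r ->
  x \in S -> y \in S -> x != y -> common_circuit S r x y.
Proof.
move: {2}#|S| (leqnn #|S|) => n.
elim: n S r => [|n IHn] S r; first by rewrite leqn0 cards_eq0 => /eqP-> _ _; rewrite inE.
move=> Sn rr cS xS yS xy.
have [e /setDP[eS exy]|S2] := pickP (mem (S :\: [set x; y])).
  have [xe ye] : x \in S :\ e /\ y \in S :\ e.
    by move: exy; rewrite !inE xS yS !andbT => /norP[]; rewrite eq_sym => -> ; rewrite eq_sym.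
  have Sen : #|S :\ e| <= n by rewrite (cardsD1 e) eS in Sn.
  case/orP: (inseparable_del_or_contract rr eS cS) => c'.
    have /existsP[C /and3P[/and3P[CS rC pC] xC yC]] := IHn _ _ Sen rr c' xe ye xy.
    apply/existsP; exists C; rewrite xC yC !andbT; apply/and3P; split=> //.
    exact: subset_trans CS (subD1set _ _).
  have /existsP[C /and3P[cC xC yC]] :=
    IHn _ _ Sen (contract_is_matroid_rank e rr) c' xe ye xy.
  have [C' cC' sC] := circuit_uncontract rr eS cC.
  by apply/existsP; exists C'; rewrite cC' !(subsetP sC).
have SE : S = [set x; y].
  apply/eqP; rewrite eqEsubset subUset !sub1set xS yS !andbT -setD_eq0.
  by apply/eqP/setP => z; rewrite in_set0; apply: S2.
have [rk rM rS] := rr.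
have r1 := rank1_le x rr; have r2 := rank1_le y rr.
have Sx : S :\: [set x] = [set y].
  apply/setP=> z; rewrite SE !inE; have [->|] := eqVneq z x; by rewrite //= (negbTE xy).
have := inseparableP cS _ _ _; move/(_ [set x]); rewrite Sx sub1set xS => /(_ isT) h.
have {h} h : r S < r [set x] + r [set y].
  apply: h; first by apply/set0Pn; exists x; rewrite inE.
  by apply: contra xy => /eqP/setP/(_ y); rewrite yS inE eq_sym.
have h1 : r [set x] <= r S by rewrite rM // sub1set.
have h2 : r [set y] <= r S by rewrite rM // sub1set.
apply/existsP; exists S; rewrite xS yS !andbT; apply/and3P; split=> //.
  by rewrite {2}SE cards2 xy; lia.
apply/forallP => D; apply/implyP => pD.
have D1 : #|D| <= 1 by move/proper_card: pD; rewrite SE cards2 xy.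
have [->|[z zD]] := set_0Vmem D; first by rewrite (rank0 rr) cards0.
have DE : D = [set z] by apply/eqP; rewrite eq_sym eqEcard sub1set zD cards1.
have := subsetP (proper_sub pD) _ zD.
by rewrite SE DE cards1 !inE => /orP[] /eqP ->; lia.
Qed.

(** The component of [x] is the smallest separator containing [x]: circuits through [x] cannot leave
    it, and it is inseparable, so each of its elements shares a circuit with [x]. *)
Lemma component_skew S r x : is_matroid_rank r -> x \in S ->
  r (component S r x) + r (S :\: component S r x) <= r S.
Proof.
move=> rr xS; have [rk rM rS] := rr.
pose p A := [&& x \in A, A \subset S & r A + r (S :\: A) <= r S].
have pS : p S by rewrite /p xS subxx setDv (rank0 rr) addn0 leqnn.
case: (arg_minnP (fun A => #|A|) pS) => A /and3P[xA AS hA] Amin.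
suff -> : component S r x = A by [].
(* If [B] separated [A], then [B] or [A :\: B], whichever contains [x], would be a smaller separator
   of [S]. *)
have cA : inseparable A r.
  apply/negPn/negP => /inseparablePn [B /and3P[BA B0 BnA] hB].
  have E1 : S :\: B = (A :\: B) :|: (S :\: A).
    apply/setP=> z; rewrite !inE; have := subsetP AS z; have := subsetP BA z.
    by case: (z \in A); case: (z \in B); case: (z \in S) => //= h1 h2; 
      try (by have := h1 isT); try (by have := h2 isT).
  have E2 : S :\: (A :\: B) = B :|: (S :\: A).
    apply/setP=> z; rewrite !inE; have := subsetP AS z; have := subsetP BA z.
    by case: (z \in A); case: (z \in B); case: (z \in S) => //= h1 h2;
      try (by have := h1 isT); try (by have := h2 isT).
  have := rankU_le (A :\: B) (S :\: A) rr; have := rankU_le B (S :\: A) rr.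
  rewrite -E1 -E2 => u1 u2.
  have BlA : #|B| < #|A| by rewrite proper_card // properEneq BnA.
  have := cardsD A B; rewrite (setIidPr BA) => cAB.
  have B1 : 0 < #|B| by rewrite card_gt0.
  have [xB|xB] := boolP (x \in B).
    have := Amin B; rewrite /p xB (subset_trans BA AS); lia.
  have := Amin (A :\: B); rewrite /p inE xB xA (subset_trans (subsetDl _ _) AS); lia.
apply/setP=> y; rewrite inE; apply/andP/idP => [[yS /orP[/eqP->//|]]|yA].
  case/existsP=> C /and3P[cC xC yC].
  have CS : C \subset S by case/and3P: cC.
  have := @circuit_not_crossing S r C A (S :\: A) rr cC.
  rewrite (subset_setUD AS).
  case/(_ CS _ hA)/orP; first by rewrite -setI_eq0 setIDA setDIl setDv set0I.
    by move/subsetP; apply.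
  by move/subsetP/(_ x xC); rewrite inE xA.
split; first exact: (subsetP AS).
have [//|yx] := eqVneq y x; rewrite eq_sym in yx.
have /existsP[C /and3P[/and3P[CA rC pC] xC yC]] := inseparable_common_circuit rr cA xA yA yx.
apply/existsP; exists C; rewrite xC yC !andbT; apply/and3P; split=> //.
exact: subset_trans CA AS.
Qed.

(** A certificate for depth at most [d]. Unlike in [cdd_rec], any separator may be used for a split,
    and an element may be removed whether or not [S] is connected, so upper bounds can be assembled
    freely. *)
Inductive shallow : nat -> {set T} -> ({set T} -> nat) -> Prop :=
| shallow_small d S r : #|S| <= 1 -> shallow d.+1 S r
| shallow_split d S A r : A \subset S -> r A + r (S :\: A) <= r S ->
    shallow d A r -> shallow d (S :\: A) r -> shallow d S r
| shallow_contract d S r e : e \in S ->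
    shallow d (S :\ e) (contract_rk r e) -> shallow d.+1 S r
| shallow_delete d S r e : e \in S -> shallow d (S :\ e) r -> shallow d.+1 S r.

Lemma shallow_gt0 d S r : shallow d S r -> 0 < d.
Proof. by elim. Qed.

Lemma shallowS d S r : shallow d S r -> shallow d.+1 S r.
Proof.
elim=> {d S r} [d S r|d S A r AS h _ IHA _ IHB|d S r e eS _|d S r e eS _].
- exact: shallow_small.
- exact: shallow_split h IHA IHB.
- exact: shallow_contract.
- exact: shallow_delete.
Qed.

Lemma shallow_leq d d' S r : d <= d' -> shallow d S r -> shallow d' S r.
Proof.
move/subnK<-; elim: (d' - d) => // n IHn sh; exact: shallowS (IHn sh).
Qed.
End Connectivity.

Lemma imset_setD (T T' : finType) (f : T -> T') (A B : {set T}) :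
  injective f -> f @: (A :\: B) = f @: A :\: f @: B.
Proof.
move=> fI; apply/setP=> y; rewrite inE; apply/imsetP/andP => [[x]|[nB /imsetP[x xA ye]]].
  by rewrite inE => /andP[nB xA] ->; rewrite mem_imset ?imset_f.
by exists x; rewrite // inE xA andbT; apply: contra nB => xB; rewrite ye imset_f.
Qed.

Lemma shallow_transfer (T T' : finType) (f : T -> T') d (S : {set T}) r r' :
  injective f -> (forall Y : {set T}, Y \subset S -> r' (f @: Y) = r Y) ->
  shallow d S r -> shallow d (f @: S) r'.
Proof.
move=> fI req sh; elim: sh r' req => {d S r}
  [d S r S1|d S A r AS h _ IHA _ IHB|d S r e eS _ IH|d S r e eS _ IH] r' req.
- by apply: shallow_small; rewrite card_imset.
- apply: (@shallow_split _ _ _ (f @: A)); first exact: imsetS.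
  + by rewrite -imset_setD // !req // subsetDl.
  + by apply: IHA => Y sY; rewrite req // (subset_trans sY).
  + rewrite -imset_setD //.
    by apply: IHB => Y sY; rewrite req // (subset_trans sY) // subsetDl.
- have fe : f @: S :\ f e = f @: (S :\ e).
    by rewrite imset_setD ?imset_set1.
  apply: (@shallow_contract _ _ _ _ (f e)); first exact: imset_f.
  rewrite fe; apply: IH => Y sY; rewrite /contract_rk -imset_set1 -imsetU !req //.
    by rewrite sub1set.
  by rewrite subUset sub1set eS (subset_trans sY) // subD1set.
- have fe : f @: S :\ f e = f @: (S :\ e).
    by rewrite imset_setD ?imset_set1.
  apply: (@shallow_delete _ _ _ _ (f e)); first exact: imset_f.
  by rewrite fe; apply: IH => Y sY; rewrite req // (subset_trans sY) // subD1set.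
Qed.

(** * Certificates bound the contraction-deletion-depth *)

Section ShallowCdd.
Variable T : finType.
Implicit Types (r : {set T} -> nat) (A B C D S X Y : {set T}) (e x y : T).

Lemma eq_shallow d S r r' : (forall Y, Y \subset S -> r' Y = r Y) ->
  shallow d S r -> shallow d S r'.
Proof.
move=> req; rewrite -{2}(imset_id S); apply: shallow_transfer => // Y sY.
by rewrite imset_id req.
Qed.

(** The derivation is followed step by step: a split of [S] is intersected with [A], a step at an
    element of [A] is kept, and a step at an element outside [A] is dropped. *)
Lemma shallow_separator d S r A : is_matroid_rank r -> shallow d S r ->
  A \subset S -> r A + r (S :\: A) <= r S -> shallow d A r.
Proof.
move=> rr sh; elim: sh A rr => {d S r}
  [d S r S1|d S B r BS h _ IHA _ IHB|d S r e eS _ IH|d S r e eS _ IH] A rr AS hA.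
- by apply: shallow_small; apply: leq_trans S1; apply: subset_leq_card.
- have sk X Y X' Y' : X :|: Y = S -> r X + r Y <= r S -> X' \subset X -> Y' \subset Y ->
    r X' + r Y' <= r (X' :|: Y').
    by move=> <- hXY sX sY; apply: skew_sub hXY.
  have UB : B :|: S :\: B = S by apply: subset_setUD.
  have UA : A :|: S :\: A = S by apply: subset_setUD.
  apply: (@shallow_split _ _ _ (A :&: B)); first exact: subsetIl.
  + have := @sk _ _ (A :&: B) (A :\: B) UB h (subsetIr _ _) (setSD _ AS).
    by rewrite setDIr setDv set0U setID.
  + apply: IHA => //; first exact: subsetIr.
    have := @sk _ _ (A :&: B) (B :\: (A :&: B)) UA hA (subsetIl _ _).
    rewrite setDIr setDv setU0 (setSD _ BS) => /(_ isT).
    by rewrite (setIC A B) setID.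
  + rewrite setDIr setDv set0U; apply: IHB => //; first exact: setSD.
    have s1 : S :\: B :\: (A :\: B) \subset S :\: A.
      apply/subsetP=> z; rewrite !inE.
      by case: (z \in A); case: (z \in B); case: (z \in S).
    have := @sk _ _ (A :\: B) (S :\: B :\: (A :\: B)) UA hA (subsetDl _ _) s1.
    by rewrite subset_setUD // setSD.
- have [eA|eA] := boolP (e \in A).
    apply: (shallow_contract eA); apply: IH; first exact: contract_is_matroid_rank.
      exact: setSD.
    have := contract_rkK e (A :\ e) rr; have := contract_rkK e (S :\ e :\: (A :\ e)) rr.
    have := contract_rkK e (S :\ e) rr; rewrite !setD1K //.
    have -> : S :\ e :\: (A :\ e) = S :\: A.
      apply/setP=> z; rewrite !inE; have [->|ne] := eqVneq z e; last by [].
      by rewrite eA.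
    have := rankU_le [set e] (S :\: A) rr.
    lia.
  (* Here [e] lies in [S :\: A], which is skew to [A], so contracting [e] leaves the ranks inside
     [A] unchanged. *)
  apply/shallowS/(@eq_shallow _ _ (contract_rk r e)) => [Y sY|].
    have := contract_rkK e Y rr; have := rankU_le [set e] Y rr.
    have UA : A :|: S :\: A = S by apply: subset_setUD.
    have := @skew_sub _ r A (S :\: A) Y [set e] rr sY; rewrite UA sub1set inE eA eS setUC.
    move=> /(_ isT hA); lia.
  have eSA : e \in S :\: A by rewrite inE eA.
  apply: IH; first exact: contract_is_matroid_rank.
    by rewrite subsetD1 AS.
  have := contract_rkK e A rr; have := contract_rkK e (S :\ e :\: A) rr.
  have := contract_rkK e (S :\ e) rr; rewrite !setD1K //.
  have -> : e |: S :\ e :\: A = S :\: A.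
    by apply/setP=> z; rewrite !inE; have [->|] := eqVneq z e; rewrite ?eA ?eS.
  have := rankU_le [set e] A rr; lia.
- have UA : A :|: S :\: A = S by apply: subset_setUD.
  have sk X : X \subset A -> S :\ e :\: X \subset S :\: A ->
      X \subset S :\ e -> r X + r (S :\ e :\: X) <= r (S :\ e).
    move=> XA XSA XS; have := skew_sub rr XA XSA; rewrite UA => /(_ hA).
    by rewrite subset_setUD.
  have [eA|eA] := boolP (e \in A).
    apply: (shallow_delete eA); apply: IH => //; first exact: setSD.
    apply: sk; [exact: subD1set| |exact: setSD].
    apply/subsetP=> z; rewrite !inE.
    by case: (z == e); case: (z \in A); case: (z \in S).
  have AS' : A \subset S :\ e by rewrite subsetD1 AS.
  apply/shallowS/IH => //; apply: sk => //.
  by apply: setSD; apply: subD1set.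
Qed.

Lemma seqmin_le (s : seq nat) m : m \in s -> seqmin s <= m.
Proof.
rewrite /seqmin; move: (head 0 s) => a.
elim: s => //= b s IHs; rewrite inE geq_min => /orP[/eqP->|/IHs->].
  by rewrite leqnn.
by rewrite orbT.
Qed.

Lemma mconnected_separator S r A : is_matroid_rank r -> mconnected S r ->
  A \subset S -> r A + r (S :\: A) <= r S -> A = set0 \/ A = S.
Proof.
move=> rr cS AS hA; have [->|[x xA]] := set_0Vmem A; first by left.
right; apply/eqP; rewrite eqEsubset AS /=; apply/subsetP => y yS.
apply/negPn/negP => yA.
have xy : x != y by apply: contraNneq yA => <-.
have /existsP[C /and3P[cC xC yC]] : common_circuit S r x y.
  move/forallP: cS => /(_ x); rewrite (subsetP AS) //= => /forallP /(_ y).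
  by rewrite yS xy.
have CS : C \subset S by case/and3P: cC.
have := @circuit_not_crossing _ S r C A (S :\: A) rr cC.
rewrite (subset_setUD AS).
case/(_ CS _ hA)/orP; first by rewrite -setI_eq0 setIDA setDIl setDv set0I.
  by move/subsetP/(_ y yC); apply/negP.
by move/subsetP/(_ x xC); rewrite inE xA.
Qed.

(** Any fuel [n] is allowed because exhausted fuel returns 0. For connected [S] every split in the
    certificate is trivial, so the inner induction runs down to its first contraction or deletion;
    otherwise the certificate is restricted to each component. *)
Theorem shallow_cdd_rec d S r n : is_matroid_rank r -> shallow d S r ->
  cdd_rec n S r <= d.
Proof.
elim: n d S r => // n IHn d S r rr sh /=.
case: ifPn => [_|S1]; first exact: shallow_gt0 sh.
case: ifPn => [cS|_]; last first.
  apply/bigmax_leqP => x xS; apply: IHn => //.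
  apply: shallow_separator sh _ _ => //; last exact: component_skew.
  by apply/subsetP=> y; rewrite inE => /andP[].
elim: sh rr S1 cS => {d S r}
  [d S r S1|d S A r AS h _ IHA _ IHB|d S r e eS sh _|d S r e eS sh _] rr nS1 cS.
(* The empty set counts as connected, and [seqmin] of the empty list is 0, so [cdd_rec] returns 1
   here. *)
- have -> : S = set0.
    apply/eqP; rewrite -cards_eq0; move: nS1 S1; by case: #|S| => [|[]].
  by rewrite enum_set0.
- have [A0|AE] := mconnected_separator rr cS AS h.
    by rewrite A0 setD0 in IHB; apply: IHB.
  by rewrite AE in IHA; apply: IHA.
- rewrite ltnS; apply: leq_trans (IHn _ _ _ (contract_is_matroid_rank e rr) sh).
  apply: leq_trans (geq_minl _ (cdd_rec n (S :\ e) r)).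
  by apply: seqmin_le; apply/mapP; exists e; rewrite ?mem_enum.
- rewrite ltnS; apply: leq_trans (IHn _ _ _ rr sh).
  apply: leq_trans (geq_minr (cdd_rec n (S :\ e) (contract_rk r e)) _).
  by apply: seqmin_le; apply/mapP; exists e; rewrite ?mem_enum.
Qed.
End ShallowCdd.

(** * Decomposition trees *)

(* A decomposition tree of height [d] rooted at its centre, read as nested partitions of [X]. *)
Fixpoint decomposable (E : finType) (r : {set E} -> nat) (k d : nat) (X : {set E}) : Prop :=
  #|X| <= 1 \/
  if d is d'.+1 then
    exists P : {set {set E}},
      [/\ trivIset P, cover P = X,
          forall Q : {set {set E}}, Q \subset P ->
            r (cover Q) + r (cover (P :\: Q)) <= r X + k &
          forall B, B \in P -> decomposable r k d' B]
  else False.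

Lemma matroid_rank (E : finType) (M : matroid E) : is_matroid_rank (rk M).
Proof. by split; [exact: rk_le_card|exact: rk_mono|exact: rk_submod]. Qed.

Lemma connectivity_sub (E : finType) (r : {set E} -> nat) (A B B' : {set E}) k :
  is_matroid_rank r -> B' \subset B -> r A + r B <= r (A :|: B) + k ->
  r A + r B' <= r (A :|: B') + k.
Proof.
move=> [_ rM rS] sB h; have := rS (A :|: B') B; rewrite -setUA (setUidPr sB).
have : r B' <= r ((A :|: B') :&: B) by rewrite rM // subsetI sB subsetUr.
lia.
Qed.

Lemma coverUD (E : finType) (P Q : {set {set E}}) : Q \subset P ->
  cover Q :|: cover (P :\: Q) = cover P.
Proof. by move=> QP; rewrite /cover -bigcup_setU subset_setUD. Qed.

(** * From decomposition trees to nested partitions *)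

Section Tree.
Variables (n : nat) (g : rel 'I_n).
Hypothesis tree : is_tree g.
Implicit Types (u v w p z : 'I_n) (q : seq 'I_n).

Let gsym : symmetric g. Proof. by case: tree. Qed.

Definition avoid v : rel 'I_n := fun a b => g a b && (a != v) && (b != v).

Lemma avoid_sym v : connect_sym (avoid v).
Proof.
by apply: sym_connect_sym => a b; rewrite /avoid gsym -!andbA; congr (_ && _); rewrite andbC.
Qed.

Lemma tree_irrefl u w : g u w -> w != u.
Proof. by move=> h; apply: contraTneq h => ->; case: tree => _ _ -> . Qed.

Lemma comp_at_refl v u : u \in comp_at g v u.
Proof. by rewrite inE. Qed.

Lemma comp_at_neq v u w : u != v -> w \in comp_at g v u -> w != v.
Proof.
rewrite inE => uv /connectP[q + ->]; elim: q u uv => //= a q IHq u uv /andP[/andP[_ av]].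
exact: IHq.
Qed.

Lemma comp_at_step v u a b : a \in comp_at g v u -> g a b -> a != v -> b != v ->
  b \in comp_at g v u.
Proof.
rewrite !inE => h1 gab av bv; apply: connect_trans h1 _; apply: connect1.
by rewrite gab av.
Qed.

(** Otherwise the edge from [v] to [u'] followed by a walk to [u] avoiding [v] would bypass the edge
    from [v] to [u], against acyclicity. *)
Lemma comp_at_uniq v u u' w : g v u -> g v u' ->
  w \in comp_at g v u -> w \in comp_at g v u' -> u = u'.
Proof.
move=> vu vu'; rewrite !inE => c1 c2; apply/eqP/negPn/negP => uu'.
have [_ _ _ _ /(_ v u vu)/negP] := tree; apply.
have vNu' := tree_irrefl vu'; have vNu := tree_irrefl vu.
apply: (@connect_trans _ _ u').
  apply: connect1; rewrite vu' /=; apply: contra uu' => /eqP/setP/(_ u).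
  by rewrite !inE eqxx orbT (negbTE vNu).
have : connect (avoid v) u' u by apply: connect_trans c2 _; rewrite (avoid_sym v).
apply: connect_sub => a b /andP[/andP[gab av] bv]; apply: connect1; rewrite gab /=.
apply: contra av => /eqP/setP/(_ v); rewrite !inE eqxx /= => /orP[/eqP->//|/eqP vb].
by rewrite vb eqxx in bv.
Qed.

Lemma path_comp_at v w q : path g w q -> v \notin w :: q -> last w q \in comp_at g v w.
Proof.
move=> pq vq; rewrite inE; apply/connectP; exists q => //.
elim: q w pq vq => //= a q IHq w /andP[gwa pq]; rewrite !inE !negb_or.
move=> /and3P[vw va vq]; rewrite IHq ?inE ?negb_or ?va // andbT gwa.
by rewrite eq_sym vw eq_sym va.
Qed.

(** The path is made simple first. Then its tail avoids [u] and so stays in one component at [u],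
    and its smaller size lets heights decrease by one. *)
Lemma path_head u z q : path g u q -> last u q = z -> z != u ->
  exists w q', [/\ g u w, path g w q', u \notin w :: q', last w q' = z &
                  size q' < size q /\ {subset w :: q' <= q}].
Proof.
move=> pq <-; case/shortenP: pq => q1 pq1 uq1 sq1 .
case: q1 pq1 uq1 sq1 => [|w q'] /=; first by rewrite eqxx.
move=> /andP[guw pq'] /andP[uN uq'] sub _; exists w, q'; split=> //; split=> //.
apply: (uniq_leq_size (s1 := w :: q')) => // x xs; exact: sub.
Qed.

Definition height_le d p u := forall z, z \in comp_at g p u ->
  exists q, [/\ path g u q, p \notin u :: q, last u q = z & size q <= d].

(** A walk from [w] avoiding [u] never meets [p], since [p] lies in a different component at [u]. *)
Lemma comp_at_child p u w z : g p u -> g u w -> w != p ->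
  z \in comp_at g u w -> z \in comp_at g p u.
Proof.
move=> gpu guw wp; have guP : g u p by rewrite gsym.
have avoids a : a \in comp_at g u w -> a != p.
  move=> aw; apply: contraNneq wp => ap; rewrite ap in aw.
  by rewrite (comp_at_uniq guw guP aw (comp_at_refl _ _)).
have up : u != p := tree_irrefl gpu.
rewrite inE => /connectP[q + ->].
have := comp_at_step (comp_at_refl p u) guw up wp.
have : w \in comp_at g u w by apply: comp_at_refl.
move: {1 3 4 5}w => a; elim: q a => //= b q IHq a aw ap /andP[/andP[/andP[gab au] bu] pq].
have bw := comp_at_step aw gab au bu.
by apply: IHq => //; apply: comp_at_step ap gab _ _; apply: avoids.
Qed.

Lemma height_le_child d p u w : g p u -> height_le d.+1 p u -> g u w -> w != p ->
  height_le d u w.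
Proof.
move=> gpu hh guw wp z zw.
have [q [pq pN lq sq]] := hh z (comp_at_child gpu guw wp zw).
have zu : z != u := comp_at_neq (tree_irrefl guw) zw.
have [w' [q' [guw' pq' uN lq' [sq' _]]]] := path_head pq lq zu.
have zw' : z \in comp_at g u w' by rewrite -lq'; apply: path_comp_at.
rewrite (comp_at_uniq guw guw' zw zw'); exists q'; split=> //.
by rewrite -ltnS; apply: leq_trans sq' sq.
Qed.

Lemma comp_at_children d p u z : g p u -> height_le d p u -> z \in comp_at g p u ->
  z != u -> exists w, [/\ g u w, w != p & z \in comp_at g u w].
Proof.
move=> gpu hh /hh[q [pq pN lq _]] zu.
have [w [q' [guw pq' uN lq' [_ sub]]]] := path_head pq lq zu.
exists w; split=> //; last by rewrite -lq'; apply: path_comp_at.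
apply: contraNneq pN => <-; rewrite inE sub ?orbT //; exact: mem_head.
Qed.

Variables (E : finType) (M : matroid E) (leaf : E -> 'I_n) (k : nat).
Hypothesis leaf_inj : injective leaf.
Hypothesis leaf_codom : forall v, (v \in codom leaf) = (deg g v <= 1).
Hypothesis lambda_le : forall v, 1 < deg g v -> lambda_star M g leaf v <= k.

Definition branch p u : {set E} := [set x | leaf x \in comp_at g p u].

Lemma mem_branch p u x : (x \in branch p u) = (leaf x \in comp_at g p u).
Proof. by rewrite inE. Qed.

Lemma card_leaf_le1 (X : {set E}) u : (forall x, x \in X -> leaf x = u) -> #|X| <= 1.
Proof.
move=> h; apply/card_le1_eqP => x y /h hx /h hy.
by apply: leaf_inj; rewrite hx hy.
Qed.

(** [N] may omit the parent of [u]. The bound from [lambda_star] concerns all branches at [u];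
    [connectivity_sub] then discards the branches outside [N] from one side. *)
Lemma decomposable_node d u (N : {set 'I_n}) (X : {set E}) :
  1 < deg g u -> N \subset nbrs g u ->
  (forall x, (x \in X) = [exists w in N, x \in branch u w]) ->
  (forall w, w \in N -> decomposable (rk M) k d (branch u w)) ->
  decomposable (rk M) k d.+1 X.
Proof.
move=> du NN XE dec; right; have rr := matroid_rank M.
have gN w : w \in N -> g u w by move/(subsetP NN); rewrite inE.
exists [set branch u w | w in N]; split.
- apply/trivIsetP => _ _ /imsetP[w wN ->] /imsetP[w' wN' ->] ne.
  rewrite -setI_eq0; apply/eqP/setP => x; rewrite in_setI in_set0 !mem_branch; apply/negP => /andP[h1 h2].
  by case/eqP: ne; rewrite (comp_at_uniq (gN _ wN) (gN _ wN') h1 h2).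
- apply/setP => x; rewrite XE; apply/bigcupP/existsP => [[_ /imsetP[w wN ->] xw]|[w /andP[wN xw]]].
    by exists w; rewrite wN.
  by exists (branch u w) => //; apply: imset_f.
- move=> Q QP; set I := [set w in N | branch u w \in Q].
  have INN : I \subset nbrs g u.
    by apply/subsetP => w; rewrite inE => /andP[/(subsetP NN)].
  have QE : cover Q = Xpart g leaf u I.
    apply/setP => x; rewrite inE; apply/bigcupP/existsP => [[B BQ xB]|[w]].
      have /imsetP[w wN BE] := subsetP QP _ BQ; exists w.
      by rewrite inE wN -BE BQ /=; rewrite BE inE in xB.
    by rewrite inE => /andP[/andP[wN wQ] xw]; exists (branch u w); rewrite // inE.
  have QC : cover ([set branch u w | w in N] :\: Q) \subset Xpart g leaf u (nbrs g u :\: I).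
    apply/subsetP => x /bigcupP[B /setDP[/imsetP[w wN ->] wQ]]; rewrite mem_branch => xw.
    rewrite inE; apply/existsP; exists w; rewrite xw andbT in_setD (subsetP NN) // andbT.
    by rewrite inE wN.
  have XP : cover Q :|: cover ([set branch u w | w in N] :\: Q) = X.
    rewrite coverUD //; apply/setP => x; rewrite XE.
    apply/bigcupP/existsP => [[_ /imsetP[w wN ->] xw]|[w /andP[wN xw]]].
      by exists w; rewrite wN.
    by exists (branch u w) => //; apply: imset_f.
  rewrite -{1}XP; apply: connectivity_sub rr QC _; rewrite QE.
  have /bigmax_leqP/(_ I INN) := lambda_le du.
  by rewrite /lam leq_subLR.
- by move=> _ /imsetP[w wN ->]; apply: dec.
Qed.

Lemma decomposable_branch d p u : g p u -> height_le d p u ->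
  decomposable (rk M) k d (branch p u).
Proof.
elim: d p u => [|d IHd] p u gpu hh.
  left; apply: (@card_leaf_le1 _ u) => x; rewrite mem_branch => /hh[q [_ _ <-]].
  by case: q.
(* A vertex of degree at most 1 has no neighbour besides [p], so its branch holds no element placed
   anywhere but at [u]. *)
have [du|du] := leqP (deg g u) 1.
  left; apply: (@card_leaf_le1 _ u) => x; rewrite mem_branch => xu; apply/eqP/negPn/negP => xNu.
  have [w [guw wp _]] := comp_at_children gpu hh xu xNu.
  move: du; rewrite leqNgt => /negP; apply; rewrite /deg (cardsD1 p) (cardsD1 w) !inE.
  by rewrite gsym gpu guw wp.
apply: (@decomposable_node _ u (nbrs g u :\ p)) => //.
- exact: subD1set.
- move=> x; rewrite mem_branch; apply/idP/existsP => [xu|[w]].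
    have xNu : leaf x != u.
      apply: contraTneq du => xE; rewrite -leqNgt -leaf_codom -xE; exact: codom_f.
    have [w [guw wp xw]] := comp_at_children gpu hh xu xNu.
    by exists w; rewrite mem_branch xw !inE wp guw.
  rewrite mem_branch 3!inE => /andP[/andP[wp guw] xw].
  exact: comp_at_child gpu guw wp xw.
- move=> w; rewrite !inE => /andP[wp guw]; apply: IHd => //.
  exact: height_le_child gpu hh guw wp.
Qed.

Lemma decomposable_tree : radius_le g k -> decomposable (rk M) k k [set: E].
Proof.
case=> c hc; have rr := matroid_rank M.
have child z : z != c -> exists w, g c w /\ z \in comp_at g c w.
  move=> zc; have [q [pq lq _]] := hc z.
  have [w [q' [gcw pq' cN lq' _]]] := path_head pq lq zc.
  by exists w; split=> //; rewrite -lq'; apply: path_comp_at.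
have hh d w : k = d.+1 -> g c w -> height_le d c w.
  move=> kd gcw z zw; have zc : z != c := comp_at_neq (tree_irrefl gcw) zw.
  have [q [pq lq sq]] := hc z.
  have [w' [q' [gcw' pq' cN lq' [sq' _]]]] := path_head pq lq zc.
  have zw' : z \in comp_at g c w' by rewrite -lq'; apply: path_comp_at.
  rewrite (comp_at_uniq gcw gcw' zw zw'); exists q'; split=> //.
  by rewrite -ltnS -kd; apply: leq_trans sq' sq.
(* Only the second [k], the depth, is split; the first remains the connectivity bound. *)
case kd : {2}k => [|d].
  left; apply: (@card_leaf_le1 _ c) => x _; have [q [_ <-]] := hc (leaf x).
  by rewrite kd; case: q.
have dec w : g c w -> decomposable (rk M) k d (branch c w).
  by move=> gcw; apply: decomposable_branch gcw (hh _ _ kd gcw).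
have [dc|dc] := leqP (deg g c) 1; last first.
  apply: (@decomposable_node _ c (nbrs g c)) => // [x|w]; last by rewrite inE; apply: dec.
  rewrite inE; apply/esym/existsP.
  have xNc : leaf x != c.
    apply: contraTneq dc => xE; rewrite -leqNgt -leaf_codom -xE; exact: codom_f.
  by have [w [gcw xw]] := child _ xNc; exists w; rewrite mem_branch xw inE gcw.
(* The centre may itself be a leaf; its element then forms a block of rank at most 1. *)
have [c0|[w]] := set_0Vmem (nbrs g c).
  left; apply: (@card_leaf_le1 _ c) => x _; apply/eqP/negPn/negP => /child[w [gcw _]].
  by have := in_set0 w; rewrite -c0 inE gcw.
rewrite inE => gcw.
have /codomP[xc xcE] : c \in codom leaf by rewrite leaf_codom.
have only w' : g c w' -> w' = w.
  move=> gcw'; apply: (card_le1_eqP (A := mem [set u | g c u])) => //; rewrite inE //.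
right; exists [set [set xc]; branch c w].
have P1 : cover [set [set xc]; branch c w] = setT.
  apply/setP => x; rewrite in_setT; apply/bigcupP.
  have [xE|xNc] := eqVneq (leaf x) c.
    exists [set xc]; first by rewrite !inE eqxx.
    by rewrite inE; apply/eqP/leaf_inj; rewrite xE.
  have [w' [/only-> xw]] := child _ xNc.
  by exists (branch c w); [rewrite !inE eqxx orbT|rewrite inE].
split=> //.
- have dis : [disjoint [set xc] & branch c w].
    rewrite disjoints1 inE -xcE; apply/negP => cw.
    by have := comp_at_neq (tree_irrefl gcw) cw; rewrite eqxx.
  apply/trivIsetP => A B; rewrite !inE => /orP[]/eqP-> /orP[]/eqP->; rewrite ?eqxx // => _.
  by rewrite disjoint_sym.
- move=> Q QP; have [rC rM rS] := rr.
  have small (Y : {set E}) : Y \subset [set xc] -> rk M Y <= k.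
    move=> sY; apply: leq_trans (rM _ _ sY) _; apply: leq_trans (rank1_le xc rr) _.
    by rewrite kd.
  have full (Y : {set E}) : rk M Y <= rk M setT by apply: rM; apply: subsetT.
  have [bQ|bQ] := boolP (branch c w \in Q).
    apply: leq_add (full _) _; apply/small/bigcupsP => B /setDP[].
    by rewrite !inE => /orP[/eqP->//|/eqP->]; rewrite bQ.
  rewrite addnC; apply: leq_add (full _) _; apply/small/bigcupsP => B BQ.
  have := subsetP QP _ BQ; rewrite !inE => /orP[/eqP->//|/eqP BE].
  by rewrite BE (negbTE bQ) in BQ.
- move=> B; rewrite !inE => /orP[]/eqP->; last exact: dec.
  by case: (d) => [|d'] /=; left; rewrite cards1.
Qed.

End Tree.

(** * Extensions of vector families *)

Section VectorRank.
Variable F : fieldType.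
Implicit Types V W : vectType F.

Lemma lfun_of_linear V W (f : V -> W) :
  (forall (a : F) x y, f (a *: x + y) = a *: f x + f y)%R ->
  exists h : 'Hom(V, W), h =1 f.
Proof.
move=> lin_f; pose g := HB.pack f (GRing.isLinear.Build F V W _ f lin_f) : {linear V -> W}.
by exists (linfun g) => x; rewrite lfunE.
Qed.

Lemma functional_one V (z : V) : z != 0%R ->
  exists h : 'Hom(V, F^o), h z = 1%R.
Proof.
move=> z0; exists (linfun (coord [tuple z] ord0 : V -> F^o)).
have := coord_free (X := [tuple z]) ord0 ord0; rewrite lfunE /= => -> //.
by rewrite seq1_free.
Qed.

Definition sp V (E : finType) (v : E -> V) (X : {set E}) : {vspace V} :=
  (<<[seq v x | x in X]>>)%VS.

Definition vrk V (E : finType) (v : E -> V) (X : {set E}) : nat := \dim (sp v X).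

Section Span.
Variables (V : vectType F) (E : finType).
Implicit Types (v : E -> V) (X Y : {set E}) (U : {vspace V}).

Lemma mem_sp v X x : x \in X -> v x \in sp v X.
Proof. by move=> xX; apply: memv_span; apply: image_f. Qed.

Lemma sp_subP v X U : (forall x, x \in X -> v x \in U) -> (sp v X <= U)%VS.
Proof. by move=> h; apply/span_subvP => _ /imageP[x xX ->]; apply: h. Qed.

Lemma spS v X Y : X \subset Y -> (sp v X <= sp v Y)%VS.
Proof. by move=> sXY; apply: sp_subP => x /(subsetP sXY)/mem_sp. Qed.

Lemma spU v X Y : sp v (X :|: Y) = (sp v X + sp v Y)%VS.
Proof.
apply/eqP; rewrite eqEsubv subv_add !spS ?subsetUl ?subsetUr // !andbT.
apply: sp_subP => x /setUP[xX|xY].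
  by apply: (subvP (addvSl _ _)); apply: mem_sp.
by apply: (subvP (addvSr _ _)); apply: mem_sp.
Qed.

Lemma eq_sp v v' X : {in X, v =1 v'} -> sp v X = sp v' X.
Proof.
move=> h; apply/eqP; rewrite eqEsubv; apply/andP; split; apply: sp_subP => x xX.
  by rewrite h // mem_sp.
by rewrite -h // mem_sp.
Qed.

Lemma sp1 v x : sp v [set x] = <[v x]>%VS.
Proof.
apply/eqP; rewrite eqEsubv -memvE mem_sp ?inE // andbT.
by apply: sp_subP => y /set1P->; apply: memv_line.
Qed.

Lemma sp0 v : sp v set0 = 0%VS.
Proof. by apply/eqP; rewrite -subv0; apply: sp_subP => x; rewrite inE. Qed.

Lemma sp_ind v X (Pr : V -> Prop) : Pr 0%R ->
  (forall (a : F) x y, Pr x -> Pr y -> Pr (a *: x + y)%R) ->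
  (forall x, x \in X -> Pr (v x)) -> forall p, p \in sp v X -> Pr p.
Proof.
move=> P0 PD Pv p /(@coord_span _ _ _ (in_tuple _)) ->.
elim/big_ind: _ => // [x y Px Py|i _].
  by rewrite -[x]scale1r; apply: PD.
rewrite -[(_ *: _)%R]addr0; apply: PD => //.
have /imageP[x xX ->] : ((in_tuple (image v X))`_i \in image v X)%R by apply: mem_nth.
exact: Pv.
Qed.

Lemma vrk_is_matroid_rank v : is_matroid_rank (vrk v).
Proof.
split=> [X|X Y sXY|X Y].
- by apply: leq_trans (dim_span _) _; rewrite size_image.
- exact/dimvS/spS.
- rewrite /vrk spU -(dimv_sum_cap (sp v X) (sp v Y)) leq_add2l; apply: dimvS; rewrite subv_cap.
  by rewrite !spS ?subsetIl ?subsetIr.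
Qed.

Lemma skew_cap v X Y : vrk v X + vrk v Y <= vrk v (X :|: Y) -> (sp v X :&: sp v Y = 0)%VS.
Proof.
rewrite /vrk spU -(dimv_sum_cap (sp v X) (sp v Y)) -{2}[\dim (_ + _)]addn0 leq_add2l leqn0 dimv_eq0.
by move/eqP.
Qed.

Lemma nonskew_cap v X Y : vrk v (X :|: Y) < vrk v X + vrk v Y ->
  exists2 z, z != 0%R & (z \in sp v X) && (z \in sp v Y).
Proof.
rewrite /vrk spU -(dimv_sum_cap (sp v X) (sp v Y)) -{1}[\dim (_ + _)]addn0 ltn_add2l => h.
exists (vpick (sp v X :&: sp v Y)); first by rewrite vpick0 -dimv_eq0 -lt0n.
by rewrite -memv_cap memv_pick.
Qed.
End Span.

Lemma sp_lfun V W (E : finType) (v : E -> V) (h : 'Hom(V, W)) (X : {set E}) :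
  sp (h \o v) X = (h @: sp v X)%VS.
Proof. by rewrite /sp limg_span -map_comp. Qed.

Lemma sp_imset V (E E' : finType) (f : E -> E') (v : E' -> V) (X : {set E}) :
  sp v (f @: X) = sp (v \o f) X.
Proof.
apply/eqP; rewrite eqEsubv; apply/andP; split; apply: sp_subP.
  by move=> _ /imsetP[x xX ->]; apply: (mem_sp (v \o f)).
by move=> x xX; rewrite /= mem_sp ?imset_f.
Qed.

Lemma vrk_lfun_le V W (E : finType) (v : E -> V) (h : 'Hom(V, W)) (X : {set E}) :
  vrk (h \o v) X <= vrk v X.
Proof. by rewrite /vrk sp_lfun -(limg_ker_dim h (sp v X)) leq_addl. Qed.

Lemma vrk_lfun_inj V W (E : finType) (v : E -> V) (h : 'Hom(V, W)) (X : {set E}) :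
  injective h -> vrk (h \o v) X = vrk v X.
Proof.
move=> hI; rewrite /vrk sp_lfun -(limg_ker_dim h (sp v X)).
have -> : lker h = 0%VS by apply/eqP/lker0P.
by rewrite capv0 dimv0.
Qed.
End VectorRank.

(** * Extensions with a certificate, and the operations that preserve them *)

Section Extension.
Variables (F : fieldType) (E : finType).
Implicit Types (V W : vectType F) (X Y : {set E}).

Definition ground (J : finType) X : {set E + J} :=
  [set s | if s is inl x then x \in X else true].

(* The second summand of [V * W] is spanned by the elements in [C]; contracting them
   and deleting the other elements of [J] gives back [v]. *)
Definition extendable (b : nat) V (v : E -> V) X : Prop :=
  exists (W : vectType F) (J : finType) (u : E + J -> (V * W)%type) (C : {set J}),
    [/\ {in X, forall x, (u (inl x)).1 = v x},
        forall p, (p \in sp u (inr @: C)) = (p.1 == 0%R),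
        forall j, (u (inr j)).1 \in sp v X &
        shallow b (ground J X) (vrk u)].

Lemma extendable_leq b b' V (v : E -> V) X : b <= b' ->
  extendable b v X -> extendable b' v X.
Proof.
move=> bb [W [J [u [C [h1 h2 h3 h4]]]]]; exists W, J, u, C; split=> //.
exact: shallow_leq bb h4.
Qed.

Lemma extendable_small b V (v : E -> V) X : #|X| <= 1 -> extendable b.+1 v X.
Proof.
(* Nothing is added: the auxiliary space is zero and there are no new elements. *)
move=> X1; exists 'rV[F]_0, void.
exists (fun s : E + void => match s with inl x => (v x, 0%R) | inr j => of_void _ j end), set0.
split=> // [p|].
  rewrite imset0 sp0 memv0; case: p => p1 p2 /=.
  by rewrite -pair_eqE /= [p2]thinmx0 eqxx andbT.
apply: shallow_small; apply: leq_trans X1.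
have -> : ground void X = inl @: X.
  apply/setP=> -[x|[]]; rewrite inE mem_imset //; exact: inl_inj.
exact: leq_imset_card.
Qed.

(** The auxiliary spaces [W1] and [W2] are put in direct sum. The extended halves stay skew: first
    components lie in the spans of [X1] and [X2], also for the added elements, and those spans meet
    in 0; second components lie in different summands. *)
Lemma extendable_split b V (v : E -> V) X1 X2 : [disjoint X1 & X2] ->
  vrk v X1 + vrk v X2 <= vrk v (X1 :|: X2) ->
  extendable b v X1 -> extendable b v X2 -> extendable b v (X1 :|: X2).
Proof.
move=> dX /skew_cap cap0 [W1 [J1 [u1 [C1 [i1 s1 m1 sh1]]]]] [W2 [J2 [u2 [C2 [i2 s2 m2 sh2]]]]].
have [e1 e1E] : exists h : 'Hom((V * W1)%type, (V * (W1 * W2))%type),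
    h =1 (fun p => (p.1, (p.2, 0%R))).
  apply: lfun_of_linear => a [x1 x2] [y1 y2] /=.
  by congr (_, (_, _)); rewrite /= ?scaler0 ?addr0.
have [e2 e2E] : exists h : 'Hom((V * W2)%type, (V * (W1 * W2))%type),
    h =1 (fun p => (p.1, (0%R, p.2))).
  apply: lfun_of_linear => a [x1 x2] [y1 y2] /=.
  by congr (_, (_, _)); rewrite /= ?scaler0 ?addr0.
have e1I : injective e1 by move=> [x1 x2] [y1 y2]; rewrite !e1E /= => -[-> ->].
have e2I : injective e2 by move=> [x1 x2] [y1 y2]; rewrite !e2E /= => -[-> ->].
pose f1 (s : E + J1) : E + (J1 + J2) :=
  match s with inl x => inl x | inr j => inr (inl j) end.
pose f2 (s : E + J2) : E + (J1 + J2) :=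
  match s with inl x => inl x | inr j => inr (inr j) end.
have f1I : injective f1 by move=> [x|j] [y|l] //= [->].
have f2I : injective f2 by move=> [x|j] [y|l] //= [->].
pose u (s : E + (J1 + J2)) : (V * (W1 * W2))%type :=
  match s with
  | inl x => if x \in X1 then e1 (u1 (inl x)) else e2 (u2 (inl x))
  | inr (inl j) => e1 (u1 (inr j))
  | inr (inr j) => e2 (u2 (inr j))
  end.
pose C : {set J1 + J2} := [set s | match s with inl j => j \in C1 | inr j => j \in C2 end].
have X2N x : x \in X2 -> (x \in X1) = false.
  by move=> x2; apply/negbTE; rewrite (disjointFl dX).
have uf1 : {in ground J1 X1, u \o f1 =1 e1 \o u1}.
  by move=> [x|j]; rewrite !inE //= => ->.
have uf2 : {in ground J2 X2, u \o f2 =1 e2 \o u2}.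
  by move=> [x|j]; rewrite !inE //= => /X2N ->.
have fst1 s : s \in ground J1 X1 -> (u1 s).1 \in sp v X1.
  by case: s => [x|j] //; rewrite inE => xX; rewrite i1 // mem_sp.
have fst2 s : s \in ground J2 X2 -> (u2 s).1 \in sp v X2.
  by case: s => [x|j] //; rewrite inE => xX; rewrite i2 // mem_sp.
exists (W1 * W2)%type, (J1 + J2)%type, u, C; split.
- move=> x /setUP[x1|x2] /=; first by rewrite x1 e1E i1.
  by rewrite X2N // e2E i2.
- move=> p; apply/idP/eqP => [|p0].
    move: p; apply: (sp_ind (Pr := fun p : (V * (W1 * W2))%type => p.1 = 0%R)) =>
      [//|a [x1 x2] [y1 y2] /= -> ->|_ /imsetP[[j|j] jC ->]] /=.
    + by rewrite scaler0 addr0.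
    + by rewrite e1E /=; apply/eqP; rewrite -s1 mem_sp // imset_f //; rewrite inE in jC.
    + by rewrite e2E /=; apply/eqP; rewrite -s2 mem_sp // imset_f //; rewrite inE in jC.
  have -> : p = (e1 (0, p.2.1) + e2 (0, p.2.2))%R.
    rewrite e1E e2E /=; case: p p0 => p1 [p2 p3] /= ->.
    by congr (_, (_, _)); rewrite ?addr0 ?add0r.
  apply: rpredD.
    apply: (@subvP _ _ (e1 @: sp u1 (inr @: C1))%VS); last first.
      by apply: memv_img; rewrite s1.
    rewrite -sp_lfun; apply: sp_subP => _ /imsetP[j jC ->].
    by apply: (mem_sp u (x := inr (inl j))); rewrite imset_f // inE.
  apply: (@subvP _ _ (e2 @: sp u2 (inr @: C2))%VS); last first.
    by apply: memv_img; rewrite s2.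
  rewrite -sp_lfun; apply: sp_subP => _ /imsetP[j jC ->].
  by apply: (mem_sp u (x := inr (inr j))); rewrite imset_f // inE.
- move=> [j|j] /=; rewrite ?e1E ?e2E spU /=.
    exact: subvP (addvSl _ _) _ (m1 j).
  exact: subvP (addvSr _ _) _ (m2 j).
have mem1 s : (s \in f1 @: ground J1 X1) =
    match s with inl x => x \in X1 | inr (inl _) => true | inr (inr _) => false end.
  apply/imsetP/idP => [[[x|j]]|]; first by rewrite inE => xX ->.
    by move=> _ ->.
  case: s => [x xX|[j|j] // _]; first by exists (inl x); rewrite ?inE.
  by exists (inr j); rewrite ?inE.
have mem2 s : (s \in f2 @: ground J2 X2) =
    match s with inl x => x \in X2 | inr (inl _) => false | inr (inr _) => true end.
  apply/imsetP/idP => [[[x|j]]|]; first by rewrite inE => xX ->.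
    by move=> _ ->.
  case: s => [x xX|[j|j] // _]; first by exists (inl x); rewrite ?inE.
  by exists (inr j); rewrite ?inE.
have compl : ground (J1 + J2)%type (X1 :|: X2) :\: f1 @: ground J1 X1 = f2 @: ground J2 X2.
  apply/setP => s; rewrite inE mem1 mem2 inE; case: s => [x|[j|j]] //=.
  rewrite inE; have [x2|] := boolP (x \in X2); first by rewrite X2N.
  by case: (x \in X1).
have sub1 : f1 @: ground J1 X1 \subset ground (J1 + J2)%type (X1 :|: X2).
  by apply/subsetP => s; rewrite mem1 inE; case: s => [x|[j|j]] // x1; rewrite inE x1.
apply: (@shallow_split _ _ _ (f1 @: ground J1 X1)) => //.
- rewrite -{2}(subset_setUD sub1) compl /vrk spU dimv_disjoint_sum //.
  have in1 p : p \in sp u (f1 @: ground J1 X1) -> p.1 \in sp v X1 /\ p.2.2 = 0%R.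
    rewrite sp_imset (eq_sp uf1); move: p.
    apply: (sp_ind (Pr := fun p : (V * (W1 * W2))%type => p.1 \in sp v X1 /\ p.2.2 = 0%R))
      => [|a x y [x1 x2] [y1 y2]|s sG] /=.
    + by rewrite mem0v.
    + by rewrite rpredD ?rpredZ // x2 y2 scaler0 addr0.
    + by rewrite e1E; split=> //; apply: fst1.
  have in2 p : p \in sp u (f2 @: ground J2 X2) -> p.1 \in sp v X2 /\ p.2.1 = 0%R.
    rewrite sp_imset (eq_sp uf2); move: p.
    apply: (sp_ind (Pr := fun p : (V * (W1 * W2))%type => p.1 \in sp v X2 /\ p.2.1 = 0%R))
      => [|a x y [x1 x2] [y1 y2]|s sG] /=.
    + by rewrite mem0v.
    + by rewrite rpredD ?rpredZ // x2 y2 scaler0 addr0.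
    + by rewrite e2E; split=> //; apply: fst2.
  apply/eqP; rewrite -subv0; apply/subvP => p; rewrite memv_cap memv0.
  move=> /andP[/in1[p11 p122] /in2[p21 p221]].
  have : p.1 \in (sp v X1 :&: sp v X2)%VS by rewrite memv_cap p11.
  rewrite cap0 memv0 => /eqP p0.
  by case: p p0 p221 p122 {p11 p21} => a [b' c] /= -> -> ->.
- apply: shallow_transfer sh1 => // Y sY.
  rewrite -(vrk_lfun_inj u1 Y e1I) /vrk sp_imset; congr (\dim _); apply: eq_sp => s sYs.
  by apply: uf1; apply: (subsetP sY).
- rewrite compl; apply: shallow_transfer sh2 => // Y sY.
  rewrite -(vrk_lfun_inj u2 Y e2I) /vrk sp_imset; congr (\dim _); apply: eq_sp => s sYs.
  by apply: uf2; apply: (subsetP sY).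
Qed.

(** Such an [h] realises the quotient by the line of [w] inside [V] itself: it is the identity minus
    the projection onto that line. *)
Lemma line_projection V (w : V) :
  exists h : 'End(V), forall y, (h y == 0%R) = (y \in <[w]>%VS) /\ (y - h y)%R \in <[w]>%VS.
Proof.
exists (\1%VF - projv <[w]>%VS)%R => y; rewrite !lfunE /= !lfunE /=; split; last first.
  by rewrite opprD opprK addrA subrr add0r memv_proj.
apply/idP/idP => [|yw]; last by rewrite projv_id // subrr.
by rewrite subr_eq0 => /eqP->; apply: memv_proj.
Qed.

Section OptionGround.
Variable J : finType.

Definition ground_some (s : E + J) : E + option J :=
  match s with inl x => inl x | inr j => inr (Some j) end.

Lemma ground_some_inj : injective ground_some.
Proof. by move=> [x|j] [y|l] //= [->]. Qed.

Lemma groundD1 X : ground (option J) X :\ inr None = ground_some @: ground J X.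
Proof.
apply/setP => -[x|[j|]]; rewrite !inE /=.
- apply/esym; apply/imsetP/idP => [[[y|l] //]|xX]; first by rewrite inE => yX [->].
  by exists (inl x); rewrite ?inE.
- by apply/esym/imsetP; exists (inr j); rewrite ?inE.
- by apply/esym/imsetP => -[[y|l]].
Qed.
End OptionGround.

(** The new element [None] is represented by [(w, 0)], and contracting it amounts to applying [h] to
    first components, which yields the given extension of [h \o v]. [None] stays outside [C'], so
    recovering [v] deletes it. *)
Lemma extendable_contract b V (v : E -> V) X (w : V) (h : 'End(V)) :
  (forall y, (h y == 0%R) = (y \in <[w]>%VS) /\ (y - h y)%R \in <[w]>%VS) ->
  w \in sp v X -> extendable b (h \o v) X -> extendable b.+1 v X.
Proof.
move=> hP wX [W [J [u [C [i1 s1 m1 sh]]]]].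
(* Idempotence is what makes [h] fix the first components of the old added elements, which lie in
   the image of [h]. *)
have hh y : h (h y) = h y.
  apply/eqP; rewrite eq_sym -subr_eq0 -linearB.
  by have [-> _] := hP (y - h y)%R; have [_] := hP y.
have [g gE] : exists g : 'End((V * W)%type), g =1 (fun p => (h p.1, p.2)).
  apply: lfun_of_linear => a [x1 x2] [y1 y2] /=.
  by congr (_, _); rewrite /= linearP.
pose u' (s : E + option J) : (V * W)%type :=
  match s with
  | inl x => (v x, (u (inl x)).2)
  | inr (Some j) => u (inr j)
  | inr None => (w, 0%R)
  end.
pose C' : {set option J} := Some @: C.
have spC : sp u' (inr @: C') = sp u (inr @: C).
  rewrite /C' -imset_comp !sp_imset; exact: eq_sp.
(* Since [h] changes vectors only by multiples of [w], which lies in the span of [X], first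
   components of added elements stay in that span. *)
have hX : (sp (h \o v) X <= sp v X)%VS.
  apply: sp_subP => x xX /=; have [_ xw] := hP (v x).
  have -> : h (v x) = (v x - (v x - h (v x)))%R by rewrite opprB addrC subrK.
  rewrite rpredB ?mem_sp //; apply: (subvP _ _ xw); by rewrite -memvE.
exists W, (option J), u', C'; split=> //.
- by move=> p; rewrite spC s1.
- by move=> [j|] //=; apply: (subvP hX).
apply: (@shallow_contract _ _ _ _ (inr None)); first by rewrite inE.
rewrite groundD1; apply: shallow_transfer sh => [|Y sY]; first exact: ground_some_inj.
(* The kernel of [g] is the line of the contracted vector, so rank-nullity for [g] computes
   [contract_rk]. *)
have kerE : lker g = <[(w, 0%R) : (V * W)%type]>%VS.
  apply/eqP; rewrite eqEsubv -memvE memv_ker gE /=; apply/andP; split.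
    apply/subvP => -[p1 p2]; rewrite memv_ker gE -pair_eqE /= => /andP[hp /eqP->].
    have [hpE _] := hP p1; move: hp; rewrite hpE => /vlineP[a ->].
    by apply/vlineP; exists a; congr (_, _); rewrite /= scaler0.
  by rewrite -pair_eqE /= eqxx andbT; have [-> _] := hP w; apply: memv_line.
have imE : (g @: sp u' (inr None |: ground_some (J := J) @: Y))%VS = sp u Y.
  rewrite -sp_lfun spU sp1 /=.
  have -> : g (w, 0%R) = 0%R by apply/eqP; rewrite -memv_ker kerE memv_line.
  rewrite -span_seq1 span_cons.
  have -> : (<[0%R : (V * W)%type]> = 0)%VS by apply/eqP; rewrite -dimv_eq0 dim_vline eqxx.
  rewrite span_nil !add0v sp_imset; apply: eq_sp => -[x|j] sYs /=; rewrite gE /=.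
    have := subsetP sY _ sYs; rewrite inE => xX; rewrite -[h (v x)]/((h \o v) x) -i1 //.
    by case: (u (inl x)).
  have : (u (inr j)).1 \in sp (h \o v) X by [].
  by rewrite sp_lfun; case/memv_imgP => y _; case: (u (inr j)) => y1 y2 /= ->; rewrite hh.
rewrite /contract_rk /vrk -(limg_ker_dim g (sp u' (inr None |: _))) imE kerE sp1 /=.
have /capv_idPr -> : (<[(w, 0%R) : (V * W)%type]> <= sp u' (inr None |: ground_some (J := J) @: Y))%VS.
  by rewrite -memvE; apply: (mem_sp u' (x := inr None)); rewrite setU11.
by rewrite addKn.
Qed.

(** An elementary lift: contracting the new coordinate axis would give back [v]. *)
Definition lift_vec V (v : E -> V) (phi : E -> F) : E -> (V * F^o)%type :=
  fun x => (v x, phi x).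

(** The new element [None] spans the added coordinate axis, which becomes part of the auxiliary
    space. It joins [C'], so that contracting it forgets [phi], while deleting it leaves the given
    extension of the lift. *)
Lemma extendable_lift b V (v : E -> V) X (phi : E -> F) :
  extendable b (lift_vec v phi) X -> extendable b.+1 v X.
Proof.
move=> [W [J [u [C [i1 s1 m1 sh]]]]].
have [a aE] : exists h : 'Hom(((V * F^o) * W)%type, (V * (F^o * W))%type),
    h =1 (fun p => (p.1.1, (p.1.2, p.2))).
  by apply: lfun_of_linear => k [[x1 x2] x3] [[y1 y2] y3].
have aI : injective a.
  by move=> [[x1 x2] x3] [[y1 y2] y3]; rewrite !aE /= => -[-> -> ->].
pose u' (s : E + option J) : (V * (F^o * W))%type :=
  match s with
  | inl x => a (u (inl x))
  | inr (Some j) => a (u (inr j))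
  | inr None => (0%R, (1%R, 0%R))
  end.
pose C' : {set option J} := None |: Some @: C.
exists (F^o * W)%type, (option J), u', C'; split.
- by move=> x xX; rewrite /= aE i1.
- move=> p; apply/idP/eqP => [|p0].
    move: p; apply: (sp_ind (Pr := fun p : (V * (F^o * W))%type => p.1 = 0%R)) =>
      [//|k [x1 x2] [y1 y2] /= -> ->|_ /imsetP[o + ->]] /=.
    + by rewrite scaler0 addr0.
    + rewrite !inE => /orP[/eqP->//|/imsetP[j jC ->]]; rewrite aE /=.
      have : u (inr j) \in sp u (inr @: C) by rewrite mem_sp // imset_f.
      by rewrite s1 => /eqP->.
  have -> : p = (p.2.1 *: ((0, (1, 0)) : (V * (F^o * W))%type) + a ((0, 0), p.2.2))%R.
    rewrite aE; case: p p0 => p1 [p2 p3] /= ->.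
    by congr (_, (_, _)); rewrite /= ?scaler0 ?addr0 ?add0r //; rewrite /GRing.scale /= mulr1.
  apply: rpredD.
    by apply: rpredZ; apply: (mem_sp u' (x := inr None)); rewrite imset_f // /C' setU11.
  apply: (@subvP _ _ (a @: sp u (inr @: C))%VS); last first.
    by apply: memv_img; rewrite s1.
  rewrite -sp_lfun; apply: sp_subP => _ /imsetP[j jC ->].
  by apply: (mem_sp u' (x := inr (Some j))); rewrite imset_f // /C' inE imset_f ?orbT.
- move=> [j|] /=; last exact: mem0v.
  rewrite aE /=; move: (m1 j); move: (u (inr j)).1.
  apply: (sp_ind (Pr := fun p : (V * F^o)%type => p.1 \in sp v X)) => [|k [x1 x2] [y1 y2]|x xX] /=.
  + exact: mem0v.
  + by move=> hx hy; rewrite rpredD // rpredZ.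
  + exact: mem_sp.
apply: (@shallow_delete _ _ _ _ (inr None)); first by rewrite inE.
rewrite groundD1; apply: shallow_transfer sh => [|Y sY]; first exact: ground_some_inj.
rewrite -(vrk_lfun_inj u Y aI) /vrk sp_imset; congr (\dim _); apply: eq_sp.
by case.
Qed.

End Extension.

(** * Separating the branches *)

(** The hypothesis says, without subtraction, that passing from [r] to [r'] raises every
    connectivity by at most [c]. *)
Lemma decomposable_perturb (E : finType) (r r' : {set E} -> nat) c k d (X : {set E}) :
  (forall A B, r' A + r' B + r (A :|: B) <= r A + r B + r' (A :|: B) + c) ->
  decomposable r k d X -> decomposable r' (k + c) d X.
Proof.
move=> hr; elim: d X => [|d IHd] X /= [X1|]; [by left|by []|by left|].
case=> P [tP cP hP bP]; right; exists P; split=> // [Q QP|B BP]; last exact/IHd/bP.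
have := hP Q QP; have := hr (cover Q) (cover (P :\: Q)); rewrite coverUD // cP; lia.
Qed.

(** * Ranks of unions of blocks *)

Section BlockRank.
Variables (E : finType) (r : {set E} -> nat).
Hypothesis rr : is_matroid_rank r.
Implicit Types P Q : {set {set E}}.

Lemma coverD1 P B : B \in P -> cover P = B :|: cover (P :\ B).
Proof. by move=> BP; rewrite /cover (big_setD1 B BP). Qed.

Lemma coverS P Q : Q \subset P -> cover Q \subset cover P.
Proof. by move=> QP; rewrite -(coverUD QP) subsetUl. Qed.

Lemma set_of_set_ind (Pr : {set {set E}} -> Prop) : Pr set0 ->
  (forall P B, B \in P -> Pr (P :\ B) -> Pr P) -> forall P, Pr P.
Proof.
move=> P0 PS P; move: {2}#|P| (erefl #|P|) => n; elim: n P => [|n IHn] P cP.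
  by have /eqP := cP; rewrite cards_eq0 => /eqP->.
have [->//|[B BP]] := set_0Vmem P; apply: (PS _ B) => //; apply: IHn.
by move: cP; rewrite (cardsD1 B) BP => -[].
Qed.

Lemma cover0 : cover set0 = set0 :> {set E}.
Proof. by rewrite /cover big_set0. Qed.

Lemma rank_cover_le P : r (cover P) <= \sum_(B in P) r B.
Proof.
elim/set_of_set_ind: P => [|P B BP IH]; first by rewrite cover0 (rank0 rr).
rewrite (coverD1 BP) (big_setD1 B BP) /=; apply: leq_trans (rankU_le _ _ rr) _.
by rewrite leq_add2l.
Qed.

(** Blocks are peeled off one at a time; the remaining ones are still skew to each other by
    [skew_sub]. *)
Lemma sum_rank_of_skew P :
  (forall B, B \in P -> r B + r (cover (P :\ B)) <= r (cover P)) ->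
  \sum_(B in P) r B <= r (cover P).
Proof.
elim/set_of_set_ind: P => [|P B BP IH] h; first by rewrite big_set0.
rewrite (big_setD1 B BP) /=; apply: leq_trans (h B BP); rewrite leq_add2l.
apply: IH => C CP; have CP' : C \in P by case/setD1P: CP.
have {1}-> : cover (P :\ B) = C :|: cover (P :\ B :\ C) by apply: coverD1.
have := h C CP'; rewrite {1}(coverD1 CP'); apply: skew_sub => //.
by apply: coverS; apply: setSD; apply: subD1set.
Qed.

(** By submodularity, the drop caused by removing [C] does not decrease once [B] has been removed.
    The sum is thus bounded by the telescoping sum of successive removals. *)
Lemma sum_rank_drop_le Q :
  \sum_(B in Q) (r (cover Q) - r (cover (Q :\ B))) <= r (cover Q).
Proof.
have [rC rM rS] := rr.
elim/set_of_set_ind: Q => [|Q B BQ IH]; first by rewrite big_set0.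
have sB : r (cover (Q :\ B)) <= r (cover Q) by apply/rM/coverS/subD1set.
rewrite (big_setD1 B BQ) /= -[leqRHS](subnK sB) leq_add2l; apply: leq_trans IH.
apply: leq_sum => C CQ; have CQ' : C \in Q by case/setD1P: CQ.
have := rS (cover (Q :\ B)) (cover (Q :\ C)).
have -> : cover (Q :\ B) :|: cover (Q :\ C) = cover Q.
  apply/eqP; rewrite eqEsubset subUset !coverS ?subD1set //=.
  rewrite (coverD1 CQ') subUset subsetUr andbT.
  by apply: subset_trans (subsetUl _ _); rewrite (coverD1 CQ) subsetUl.
have : r (cover (Q :\ B :\ C)) <= r (cover (Q :\ B) :&: cover (Q :\ C)).
  apply: rM; rewrite subsetI !coverS ?subD1set //.
  by apply: setSD; apply: subD1set.
move=> h1 h2; have h3 := rM _ _ (coverS (subD1set Q C)).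
suff arith a b c e f : c <= a -> e <= f -> a + f <= b + c -> a - c <= b - e.
  exact: arith h3 h1 h2.
by clear; lia.
Qed.

(* Take a bipartition of maximum connectivity and compare it with those obtained by moving
   one block across. *)
Lemma max_bipartition P : exists2 Q : {set {set E}}, Q \subset P &
  \sum_(B in Q) (r (cover (P :\: Q) :|: B) - r (cover (P :\: Q))) +
  \sum_(B in P :\: Q) (r (cover Q :|: B) - r (cover Q)) <=
  r (cover Q) + r (cover (P :\: Q)).
Proof.
pose p Q := Q \subset P; have p0 : p set0 by apply: sub0set.
case: (arg_maxnP (fun Q => r (cover Q) + r (cover (P :\: Q))) p0) => Q QP Qmax.
exists Q => //; apply: leq_add.
  apply: leq_trans (sum_rank_drop_le Q); apply: leq_sum => B BQ.
  have := Qmax (Q :\ B) (subset_trans (subD1set _ _) QP).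
  have -> : cover (P :\: (Q :\ B)) = cover (P :\: Q) :|: B.
    rewrite setDDr (setIidPr _) ?sub1set ?(subsetP QP) // /cover bigcup_setU.
    by rewrite big_set1.
  lia.
apply: leq_trans (sum_rank_drop_le (P :\: Q)); apply: leq_sum => B /[dup] BPQ /setDP[BP BQ].
have BQP : p (B |: Q) by rewrite /p subUset sub1set BP.
have := Qmax _ BQP.
have -> : P :\: (B |: Q) = P :\: Q :\ B by rewrite setUC setDDl.
rewrite /cover bigcup_setU big_set1 setUC -/(cover _) -/(cover _); lia.
Qed.
End BlockRank.

(** * The recursion over the decomposition and the final bound *)

Section Main.
Variables (F : fieldType) (E : finType).
Implicit Types (V W : vectType F) (X Y : {set E}) (P Q : {set {set E}}).

(** Splitting costs no depth, so independent blocks share the same [b]. Positivity of [b] serves the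
    empty partition. *)
Lemma extendable_blocks b V (v : E -> V) P : 0 < b -> trivIset P ->
  \sum_(B in P) vrk v B <= vrk v (cover P) ->
  (forall B, B \in P -> extendable b v B) -> extendable b v (cover P).
Proof.
move=> b0; have rr := vrk_is_matroid_rank v.
elim/set_of_set_ind: P => [|P B BP IH] tP sP bP.
  by rewrite cover0 -(prednK b0); apply: extendable_small; rewrite cards0.
have tP' : trivIset (P :\ B) by apply: trivIsetS tP; apply: subD1set.
have dB : [disjoint B & cover (P :\ B)].
  rewrite -setI_eq0; apply/eqP/setP => x; rewrite !inE; apply/negP => /andP[xB].
  case/bigcupP => C /setD1P[CB CP] xC.
  have /trivIsetP/(_ B C BP CP) := tP; rewrite eq_sym => /(_ CB)/disjoint_setI0/setP/(_ x).
  by rewrite !inE xB xC.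
move: sP; rewrite (coverD1 BP) (big_setD1 B BP) /= => sP.
have h1 := rank_cover_le rr (P :\ B); have h2 := rankU_le B (cover (P :\ B)) rr.
apply: extendable_split => //; first by apply: leq_trans sP; rewrite leq_add2l.
  exact: bP.
apply: IH => //; first by have := leq_trans sP h2; rewrite leq_add2l.
by move=> C /setD1P[_ /bP].
Qed.

Lemma vrk_contract V (v : E -> V) (w : V) (h : 'End(V)) Y :
  (forall y, (h y == 0%R) = (y \in <[w]>%VS) /\ (y - h y)%R \in <[w]>%VS) ->
  w != 0%R ->
  vrk v Y <= vrk (h \o v) Y + 1 /\ (w \in sp v Y -> vrk v Y = vrk (h \o v) Y + 1).
Proof.
move=> hP w0; rewrite /vrk sp_lfun -(limg_ker_dim h (sp v Y)) addnC.
have -> : lker h = <[w]>%VS by apply/vspaceP => y; rewrite memv_ker; have [-> _] := hP y.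
split=> [|wY]; rewrite ?leq_add2l.
  by apply: leq_trans (dimvS (capvSr _ _)) _; rewrite dim_vline leq_b1.
by rewrite (capv_idPr _) -?memvE // dim_vline w0.
Qed.

(** [dl Y] is the dimension of the part of the lifted span of [Y] lying in the kernel of the
    projection to [V], that is, in the new coordinate axis. *)
Lemma vrk_lift_eq V (v : E -> V) (phi : E -> F) : exists2 dl : {set E} -> nat,
  (forall Y, vrk (lift_vec v phi) Y = vrk v Y + dl Y) &
  forall Y, [/\ dl Y <= 1, forall Z : {set E}, Y \subset Z -> dl Y <= dl Z &
    ((0%R, 1%R) : (V * F^o)%type) \in sp (lift_vec v phi) Y -> 0 < dl Y].
Proof.
set v' := lift_vec v phi.
have [f fE] : exists f : 'Hom((V * F^o)%type, V), f =1 fst by apply: lfun_of_linear.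
exists (fun Y => \dim (sp v' Y :&: lker f)%VS) => Y.
  have -> : vrk v Y = vrk (f \o v') Y.
    by rewrite /vrk; congr (\dim _); apply: eq_sp => x _; rewrite /= fE.
  by rewrite /vrk sp_lfun addnC limg_ker_dim.
split.
- apply: leq_trans (dimvS (capvSr _ _)) _.
  have : (lker f <= <[((0%R, 1%R) : (V * F^o)%type)]>)%VS.
    apply/subvP => -[p1 p2]; rewrite memv_ker fE /= => /eqP->; apply/vlineP; exists p2.
    congr (_, _); rewrite /= ?scaler0 //; exact: (esym (mulr1 _)).
  by move/dimvS/leq_trans; apply; rewrite dim_vline leq_b1.
- by move=> Z YZ; apply/dimvS/capvS => //; apply: spS.
- move=> h; rewrite lt0n dimv_eq0; apply: contraTneq (oner_neq0 F) => h0.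
  have : ((0%R, 1%R) : (V * F^o)%type) \in (sp v' Y :&: lker f)%VS.
    by rewrite memv_cap h memv_ker fE /=.
  by rewrite h0 memv0 -pair_eqE /= => /andP[_ ->].
Qed.

Section Step.
Variable d : nat.
Hypothesis IHd : forall V (v : E -> V) X k,
  decomposable (vrk v) k d X -> extendable (k * (4 ^ d - 1) + 1) v X.
Variable P : {set {set E}}.
Hypothesis tP : trivIset P.

(** [rho] bounds the excess of the block ranks over the rank of the union. Each lift raises the rank
    of the union but of no block; it costs one level of depth and one unit of connectivity, so
    [k + rho] is preserved. *)
Lemma extendable_lifts rho V (v : E -> V) k :
  \sum_(B in P) vrk v B <= vrk v (cover P) + rho ->
  (forall B, B \in P -> decomposable (vrk v) k d B) ->
  extendable (rho + ((k + rho) * (4 ^ d - 1) + 1)) v (cover P).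
Proof.
elim: rho V v k => [|rho IH] V v k hs dec.
  rewrite !addn0 in hs *; apply: extendable_blocks => //; first by rewrite addn1.
  by move=> B BP; apply: IHd; apply: dec.
have [hs0|hs0] := leqP (\sum_(B in P) vrk v B) (vrk v (cover P)).
  apply: (@extendable_leq _ _ (k * (4 ^ d - 1) + 1)); first by nia.
  apply: extendable_blocks => //; first by rewrite addn1.
  by move=> B BP; apply: IHd; apply: dec.
have rr := vrk_is_matroid_rank v.
have [B BP nB] : exists2 B, B \in P & vrk v (cover P) < vrk v B + vrk v (cover (P :\ B)).
  apply/exists_inP; apply: contraTT hs0 => /exists_inPn h; rewrite -leqNgt.
  by apply: sum_rank_of_skew => // B BP; rewrite leqNgt h.
rewrite (coverD1 BP) in nB; have [z z0 /andP[zB zC]] := nonskew_cap nB.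
have [l lz] := functional_one z0.
(* The new coordinate is the functional [l] on [B] and 0 elsewhere. It is linear on every block, but
   [z] lies in the spans of both [B] and the rest, and there it takes the values 1 and 0. *)
pose phi x : F := if x \in B then l (v x) else 0%R.
pose v' := lift_vec v phi.
have [dl vE dlP] := vrk_lift_eq v phi; rewrite -/v' in vE dlP.
have [g1 g1E] : exists f : 'Hom(V, (V * F^o)%type), f =1 (fun x => (x, l x)).
  by apply: lfun_of_linear => a x y; congr (_, _); rewrite linearP.
have [g2 g2E] : exists f : 'Hom(V, (V * F^o)%type), f =1 (fun x => (x, 0%R)).
  by apply: lfun_of_linear => a x y; congr (_, _); rewrite /= GRing.scaler0 GRing.addr0.
have on1 : {in B, v' =1 g1 \o v} by move=> x xB; rewrite /v' /lift_vec /phi xB /= g1E.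
have off (B' : {set E}) : [disjoint B' & B] -> {in B', v' =1 g2 \o v}.
  by move=> dB x xB; rewrite /v' /lift_vec /phi (disjointFr dB xB) /= g2E.
have dC : [disjoint cover (P :\ B) & B].
  rewrite -setI_eq0; apply/eqP/setP => x; rewrite !inE; apply/negP => /andP[+ xB].
  case/bigcupP => C /setD1P[CB CP] xC.
  have /trivIsetP/(_ C B CP BP CB)/disjoint_setI0/setP/(_ x) := tP.
  by rewrite !inE xB xC.
have blocks B' : B' \in P -> vrk v' B' <= vrk v B'.
  move=> BP'; have [->|nBB] := eqVneq B' B.
    by rewrite /vrk (eq_sp on1); apply: vrk_lfun_le.
  have /trivIsetP/(_ B' B BP' BP nBB) dB := tP.
  by rewrite /vrk (eq_sp (off _ dB)); apply: vrk_lfun_le.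
have one : ((0%R, 1%R) : (V * F^o)%type) \in sp v' (cover P).
  have -> : (0%R, 1%R) = (g1 z - g2 z)%R.
    by rewrite g1E g2E lz; congr (_, _); rewrite /= ?GRing.subrr ?GRing.subr0.
  rewrite (coverD1 BP) spU; apply: memv_add.
    by rewrite (eq_sp on1) sp_lfun memv_img.
  by rewrite rpredN (eq_sp (off _ dC)) sp_lfun memv_img.
have := @IH _ v' k.+1; rewrite addSnnS addSn => IH'.
apply: extendable_lift (phi) _; apply: IH' => [|B' BP'].
  have [_ _ /(_ one) dl1] := dlP (cover P).
  have : \sum_(B in P) vrk v' B <= \sum_(B in P) vrk v B by apply: leq_sum.
  rewrite vE; lia.
(* [dl A] is at most [dl (A :|: D)] and [dl D] at most 1, so a lift raises connectivity by at most
   1. *)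
rewrite -addn1; apply: decomposable_perturb (dec _ BP') => A D; rewrite !vE.
have [_ h1 _] := dlP A; have [h2 _ _] := dlP D.
have := h1 (A :|: D) (subsetUl _ _); lia.
Qed.

(** [s] bounds the connectivity between the two sides. Contracting a vector common to their spans
    lowers [s] and the rank of the union by one each and leaves all the increments unchanged, so the
    second hypothesis is invariant. *)
Lemma extendable_contracts Q s rho V (v : E -> V) k : Q \subset P ->
  vrk v (cover Q) + vrk v (cover (P :\: Q)) <= vrk v (cover P) + s ->
  \sum_(B in Q) (vrk v (cover (P :\: Q) :|: B) - vrk v (cover (P :\: Q))) +
  \sum_(B in P :\: Q) (vrk v (cover Q :|: B) - vrk v (cover Q)) + s <=
    vrk v (cover P) + rho ->
  (forall B, B \in P -> decomposable (vrk v) k d B) ->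
  extendable (s + (rho + ((k + s + rho) * (4 ^ d - 1) + 1))) v (cover P).
Proof.
move=> QP; elim: s V v k => [|s IH] V v k hs hsum dec.
  rewrite add0n !addn0 in hs hsum *; apply: extendable_lifts => //.
  have rr := vrk_is_matroid_rank v; have [_ rM _] := rr.
  rewrite -(coverUD QP) in hs.
  (* The two sides are now skew, so the rank of each block is at most its increment over the
     opposite side; the increments therefore bound the excess by [rho]. *)
  rewrite (big_setID Q) (setIidPr QP) /=; apply: leq_trans hsum; apply: leq_add.
    apply: leq_sum => B BQ.
    have BQ' : B \subset cover Q by rewrite (coverD1 BQ) subsetUl.
    have := skew_sub rr BQ' (subxx (cover (P :\: Q))) hs; rewrite setUC; lia.
  apply: leq_sum => B BQ.
  have BQ' : B \subset cover (P :\: Q) by rewrite (coverD1 BQ) subsetUl.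
  have := skew_sub rr (subxx (cover Q)) BQ' hs; lia.
have [hs0|hs0] := leqP (vrk v (cover Q) + vrk v (cover (P :\: Q))) (vrk v (cover P) + s).
  have hsum' : \sum_(B in Q) (vrk v (cover (P :\: Q) :|: B) - vrk v (cover (P :\: Q))) +
    \sum_(B in P :\: Q) (vrk v (cover Q :|: B) - vrk v (cover Q)) + s <=
    vrk v (cover P) + rho by lia.
  by apply: extendable_leq (IH _ _ _ hs0 hsum' dec); nia.
have [w w0 /andP[wI wJ]] : exists2 z, z != 0%R &
    (z \in sp v (cover Q)) && (z \in sp v (cover (P :\: Q))).
  by apply: nonskew_cap; rewrite coverUD //; lia.
have [h hP] := line_projection w.
have drop Y : w \in sp v Y -> vrk v Y = (vrk (h \o v) Y).+1.
  by move=> wY; have [_ ->] := vrk_contract v Y hP w0; rewrite ?addn1.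
have wX : w \in sp v (cover P) by apply: (subvP (spS v (coverS QP))).
have wU Y Z : w \in sp v Y -> w \in sp v (Y :|: Z).
  by apply/subvP/spS; apply: subsetUl.
have := IH _ (h \o v) k.+1; rewrite addSnnS addSn => IH'.
apply: (extendable_contract hP wX); apply: IH' => [||B BP].
- by move: hs; rewrite (drop _ wI) (drop _ wJ) (drop _ wX) !addSn !addnS !ltnS.
- have sE Y (R : {set {set E}}) : w \in sp v Y ->
    \sum_(B in R) (vrk v (Y :|: B) - vrk v Y) =
    \sum_(B in R) (vrk (h \o v) (Y :|: B) - vrk (h \o v) Y).
    by move=> wY; apply: eq_bigr => B _; rewrite !drop ?wU // subSS.
  by move: hsum; rewrite (drop _ wX) !sE // addnS addSn ltnS.
(* The rank of the union falls by at most 1 and the ranks of the two parts do not rise. *)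
rewrite -addn1; apply: decomposable_perturb (dec _ BP) => A D.
have [h1 _] := vrk_contract v (A :|: D) hP w0.
have := vrk_lfun_le v h A; have := vrk_lfun_le v h D; lia.
Qed.
End Step.

Theorem extendable_decomposable d V (v : E -> V) X k :
  decomposable (vrk v) k d X -> extendable (k * (4 ^ d - 1) + 1) v X.
Proof.
elim: d V v X k => [|d IHd] V v X k /= [X1|].
- by rewrite addn1; apply: extendable_small.
- by [].
- by rewrite addn1; apply: extendable_small.
case=> P [tP <- lamP decP].
have [Q QP hQ] := max_bipartition (vrk_is_matroid_rank v) P.
have hlam := lamP Q QP.
(* With [k] contractions and [2 * k] lifts the branches have connectivity at most [4 * k], and
   [3k + 4k(4^d - 1) + 1] equals [k(4^(d+1) - 1) + 1]. *)
apply: (@extendable_leq _ _ (k + (2 * k + ((k + k + 2 * k) * (4 ^ d - 1) + 1)))).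
  by have := expn_gt0 4 d; rewrite expnS; nia.
apply: (extendable_contracts IHd tP QP hlam _ decP).
(* The increments sum to at most the ranks of the two sides, hence to the rank of the union plus
   [k]; the term [s = k] brings the excess to [2 * k]. *)
by rewrite mul2n -addnn addnA leq_add2r; apply: leq_trans hQ hlam.
Qed.

Definition vector_matroid V (v : E -> V) : matroid E :=
  let: And3 rC rM rS := vrk_is_matroid_rank v in Matroid rC rM rS.

Lemma rk_vector_matroid V (v : E -> V) X : rk (vector_matroid v) X = vrk v X.
Proof. by rewrite /vector_matroid; case: (vrk_is_matroid_rank v). Qed.

Lemma vector_matroid_representable V (v : E -> V) : representable F (vector_matroid v).
Proof.
have [h hE] : exists h : 'Hom(V, 'rV[F]_(dim V)), h =1 v2r.
  by apply: lfun_of_linear => a x y; rewrite linearP.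
have hI : injective h by move=> x y; rewrite !hE => /v2r_inj.
exists (dim V), (h \o v) => X.
by rewrite rk_vector_matroid -(vrk_lfun_inj v X hI).
Qed.
End Main.

Theorem theorem1p2 (F : fieldType) (E : finType) (M : matroid E) (k : nat) :
  representable F M -> is_bd M k ->
  exists (E' : finType) (N : matroid E'),
    [/\ representable F N, is_minor M N & cdd N <= 2 * k * (4 ^ k - 1) + 1].
Proof.
move=> [m [v vM]] [[n [g [leaf [tr rad leafI leafC lamk]]]] _].
have dec : decomposable (vrk v) k k [set: E].
  rewrite -[X in decomposable _ X]addn0.
  apply: decomposable_perturb (decomposable_tree tr leafI leafC lamk rad) => A B.
  by rewrite !vM addn0.
have [W [J [u [C [i1 s1 _ sh]]]]] := extendable_decomposable dec.
exists (E + J)%type, (vector_matroid u); split.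
- exact: vector_matroid_representable.
(* The minor contracts [C] and deletes all other added elements. The span of [C] is the kernel of
   the projection [f] to the first component, so the contracted rank is the rank of the image under
   [f]. *)
- exists (inr @: C), (inr @: ~: C), inl; split.
  + rewrite -setI_eq0 -imsetI; last by move=> ? ? _ _ [].
    by rewrite setICr imset0.
  + by move=> x y [].
  + move=> y; rewrite -imsetU setUCr; case: y => [x|j].
      rewrite codom_f; apply/esym/negP => /imsetP[j _ //].
    rewrite imset_f // ?inE //=; by apply/negP => /codomP[].
  + move=> X; rewrite vM !rk_vector_matroid -/(vrk v X).
    have [f fE] : exists f : 'Hom(('rV[F]_m * W)%type, 'rV[F]_m), f =1 fst.
      by apply: lfun_of_linear.
    have kerE : lker f = sp u (inr @: C).
      by apply/vspaceP => p; rewrite memv_ker fE s1.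
    have kerS : (lker f <= sp u (inl @: X :|: inr @: C))%VS.
      by rewrite kerE; apply/spS/subsetUr.
    rewrite /vrk -(limg_ker_dim f (sp u (inl @: X :|: _))) (capv_idPr kerS) kerE addKn.
    rewrite spU limgD -kerE; have /eqP -> : (f @: lker f == 0)%VS by rewrite -lkerE.
    rewrite addv0 sp_imset -sp_lfun; congr (\dim _); apply: eq_sp => x xX.
    by rewrite /= fE i1 ?inE.
- have gT : ground J [set: E] = setT.
    by apply/setP => -[x|j]; rewrite !inE.
  rewrite gT in sh.
  have rE Y : rk (vector_matroid u) Y = vrk u Y by apply: rk_vector_matroid.
  (* The construction gives the bound without the factor 2. *)
  apply: (@leq_trans (k * (4 ^ k - 1) + 1)); last by nia.
  apply: shallow_cdd_rec; first exact: matroid_rank.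
  by apply: eq_shallow sh.
Qed.
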